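(* Let $T>0$, let $U\subset\mathbb{R}^2$ be an open bounded set, and let $\phi\colon[0,T]\times\overline U\to\mathbb{R}^2$ be a continuous map with $\phi(0,x)=x$ for all $x\in\overline U$ and such that $0_{\mathbb{R}^2}\notin\phi([0,T]\times\partial U)$. Let $f_T\colon\overline U\to\mathbb{R}^2$, $f_T(x)=\phi(T,x)-x$, and let $F_T\colon\Psi^{-1}(\partial U)\to\mathbb{R}^2$, $F_T(y)=\Phi(T,y)-y$, where $\Phi$ is the continuous lift of $\phi$ restricted to $[0,T]\times\partial U$. Assume that $f_T(x)\ne 0$ for every $x\in\partial U$. Then $$\deg(f_T,U,0)=1+\sum_{i\in\Sigma(F_T,\partial U)}\mathfrak{D}(F_T,U,\nu_i)\qquad\text{if }0_{\mathbb{R}^2}\in U,$$ $$\deg(f_T,U,0)=\sum_{i\in\Sigma(F_T,\partial U)}\mathfrak{D}(F_T,U,\nu_i)\qquad\text{if }0_{\mathbb{R}^2}\notin\overline U.$$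
   Context: $\deg(g,U,v)$ denotes Brouwer's degree of a continuous map $g\colon\overline U\to\mathbb{R}^2$ on the open bounded set $U\subset\mathbb{R}^2$ with respect to $v\notin g(\partial U)$. Polar-like coordinates. Let $\mathscr{H}=\mathbb{R}\times(0,+\infty)$ and $\overline{\mathscr{H}}=\mathbb{R}\times[0,+\infty)$. A map $\Psi\colon\overline{\mathscr{H}}\to\mathbb{R}^2$ is fixed such that: $\Psi(\vartheta,r)$ is $2\pi$-periodic in $\vartheta$; $\Psi^{-1}(0_{\mathbb{R}^2})=\mathbb{R}\times\{0\}$; $\Psi$ is continuous and its restriction to $\mathscr{H}$ is a local homeomorphism; $\Psi$ is a bijection between $[0,2\pi)\times(0,+\infty)$ and $\mathbb{R}^2\setminus\{0_{\mathbb{R}^2}\}$; $\Psi$ is orientation preserving (e.g. clockwise polar coordinates $\Psi(\vartheta,r)=(r\cos\vartheta,-r\sin\vartheta)$). Lift. If $\phi$ is continuous, $\phi(0,\cdot)$ is the identity, and $E$ is a set with $0_{\mathbb{R}^2}\notin\phi([0,T]\times E)$, then $\Phi\colon[0,T]\times\Psi^{-1}(E)\to\mathscr{H}$ denotes the unique continuous map with $\Phi(0,\cdot)$ the identity and $\Psi(\Phi(t,y))=\phi(t,\Psi(y))$ for all $t\in[0,T]$, $y\in\Psi^{-1}(E)$. It satisfies $\Phi(t,(\vartheta+2\pi,r))=\Phi(t,(\vartheta,r))+(2\pi,0)$, so $F_T(y)=\Phi(T,y)-y$ is $2\pi$-periodic in $\vartheta$. Rotation. For a continuous $F=(F^\vartheta,F^r)\colon\Psi^{-1}(E)\to\mathbb{R}^2$,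 $2\pi$-periodic in $\vartheta$, with $0_{\mathbb{R}^2}\notin E$, and $x\in E$, set $\mathrm{rot}(F,x)=\frac{1}{2\pi}F^\vartheta(y)$ for any $y\in\Psi^{-1}(x)$, $\mathrm{rot}(F,E)=\{\mathrm{rot}(F,x):x\in E\}$, and $\Sigma(F,E)=\mathbb{Z}\cap\mathrm{conv}\,\mathrm{rot}(F,E)$, with $\mathrm{conv}$ the convex hull. For $i\in\mathbb{Z}$, $\nu_i=(2\pi i,0)$. The degree $\mathfrak{D}$. Let $U\subset\mathbb{R}^2$ be open and bounded with $0_{\mathbb{R}^2}\notin\partial U$, let $F\colon\Psi^{-1}(\partial U)\to\mathbb{R}^2$ be continuous and $2\pi$-periodic in $\vartheta$, and let $v\in\mathbb{R}^2$ with $F\neq v$ on $\Psi^{-1}(\partial U)$. Take any continuous $F_{\mathrm{ext}}\colon\overline{\mathscr{H}}\to\mathbb{R}^2$, $2\pi$-periodic in $\vartheta$, with $F_{\mathrm{ext}}=F$ on $\Psi^{-1}(\partial U)$ and $F_{\mathrm{ext}}(\cdot,0)$ constant. Then $\mathfrak{D}(F,U,v):=\deg(F_{\mathrm{ext}}\circ\Psi^{-1},U,v)$, where $F_{\mathrm{ext}}\circ\Psi^{-1}\colon\mathbb{R}^2\to\mathbb{R}^2$ is the continuous function $x\mapsto F_{\mathrm{ext}}(y)$ for any $y\in\Psi^{-1}(x)$. This does not depend on the extension. *)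

(* Defs.v *)
From HB Require Import structures.
From mathcomp Require Import all_boot all_order all_algebra.
From mathcomp Require Import all_classical all_reals all_analysis.

Set Implicit Arguments.
Unset Strict Implicit.
Unset Printing Implicit Defensive.

Import Order.TTheory GRing.Theory Num.Theory.
Import numFieldNormedType.Exports.

Local Open Scope classical_set_scope.
Local Open Scope ring_scope.

(* Maps that are only defined on a subset of their source are represented by
   total functions; only their values on that subset are ever constrained. *)

Notation plane R := (R * R)%type.

Definition bd (R : realType) (U : set (plane R)) : set (plane R) :=
  closure U `\` interior U.

(* Brouwer's degree in the plane is the unique integer-valued function of the
   admissible triples (g, U, v), i.e. U open bounded, g continuous on the
   closure of U and v outside g(bd U), that satisfies these three axioms
   (Fuehrer, Amann-Weiss; see Deimling, Nonlinear Functional Analysis, Ch. 1).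
   U may be empty; nothing is required of non-admissible triples. *)
Record brouwer_degree (R : realType)
    (d : (plane R -> plane R) -> set (plane R) -> plane R -> int) : Prop := {
  brouwer_normalization : forall (U : set (plane R)) (v : plane R),
    open U -> bounded_set U -> U v -> d id U v = 1;
  brouwer_additivity :
    forall (g : plane R -> plane R) (U U1 U2 : set (plane R)) (v : plane R),
    open U -> bounded_set U -> {within closure U, continuous g} ->
    open U1 -> open U2 -> U1 `<=` U -> U2 `<=` U -> U1 `&` U2 = set0 ->
    (forall x, closure U x -> ~ (U1 `|` U2) x -> g x <> v) ->
    d g U v = d g U1 v + d g U2 v;
  brouwer_homotopy :
    forall (h : R -> plane R -> plane R) (U : set (plane R)) (v : R -> plane R),
    open U -> bounded_set U ->
    {within `[0, 1]%classic `*` closure U,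
      continuous (fun p : R * plane R => h p.1 p.2)} ->
    {within `[0, 1]%classic, continuous v} ->
    (forall t x, `[0, 1]%classic t -> bd U x -> h t x <> v t) ->
    forall t, `[0, 1]%classic t -> d (h t) U (v t) = d (h 0) U (v 0) }.

Definition deg (R : realType) :
    (plane R -> plane R) -> set (plane R) -> plane R -> int :=
  xget (fun _ _ _ => 0) [set d | brouwer_degree d].

Definition halfplane (R : realType) : set (plane R) := [set y | 0 < y.2].
Definition chalfplane (R : realType) : set (plane R) := [set y | 0 <= y.2].
Arguments halfplane R : clear implicits.
Arguments chalfplane R : clear implicits.

Definition local_homeo_on (R : realType) (A : set (plane R))
    (p : plane R -> plane R) : Prop :=
  forall y, A y -> exists V : set (plane R),
    [/\ open V, V y, V `<=` A, open (p @` V) &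
        {within V, continuous p} /\
        exists q : plane R -> plane R,
          {within p @` V, continuous q} /\ forall z, V z -> q (p z) = z].

(* Orientation preserving for maps that are only locally homeomorphic: all the
   local degrees are equal to 1. *)
Definition orientation_preserving_on (R : realType) (A : set (plane R))
    (p : plane R -> plane R) : Prop :=
  forall (V : set (plane R)) (y : plane R),
    open V -> bounded_set V -> closure V `<=` A -> V y ->
    {within closure V, continuous p} -> set_inj (closure V) p ->
    deg p V (p y) = 1.

Definition angle_periodic (R : realType) (S : Type) (D : set (plane R))
    (F : plane R -> S) : Prop :=
  forall a r, D (a, r) -> F (a + 2 * pi, r) = F (a, r).

Record polar_coordinates (R : realType) (Psi : plane R -> plane R) : Prop := {
  polar_periodic : angle_periodic (chalfplane R) Psi;
  polar_eq0 : forall y, chalfplane R y -> (Psi y = 0 <-> y.2 = 0);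
  polar_continuous : {within chalfplane R, continuous Psi};
  polar_local_homeo : local_homeo_on (halfplane R) Psi;
  polar_bij :
    set_bij (`[0, 2 * pi[%classic `*` `]0, +oo[%classic) (~` [set 0]) Psi;
  polar_orientation : orientation_preserving_on (halfplane R) Psi }.

(* Preimage for Psi regarded as a map defined on the closed half-plane. *)
Definition polar_preim (R : realType) (Psi : plane R -> plane R)
    (E : set (plane R)) : set (plane R) :=
  chalfplane R `&` Psi @^-1` E.

(* F o Psi^-1, i.e. x |-> F y for an arbitrary y with Psi y = x. *)
Definition descend (R : realType) (S : Type) (Psi : plane R -> plane R)
    (F : plane R -> S) (x : plane R) : S :=
  F (xget 0 (polar_preim Psi [set x])).

Definition is_lift (R : realType) (Psi : plane R -> plane R) (T : R)
    (E : set (plane R)) (phi Phi : R -> plane R -> plane R) : Prop :=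
  [/\ {within `[0, T]%classic `*` polar_preim Psi E,
        continuous (fun p : R * plane R => Phi p.1 p.2)},
      forall t y, `[0, T]%classic t -> polar_preim Psi E y ->
        halfplane R (Phi t y),
      forall y, polar_preim Psi E y -> Phi 0 y = y &
      forall t y, `[0, T]%classic t -> polar_preim Psi E y ->
        Psi (Phi t y) = phi t (Psi y)].

Definition rotation (R : realType) (Psi F : plane R -> plane R) (x : plane R) : R :=
  (descend Psi F x).1 / (2 * pi).

Definition rotation_set (R : realType) (Psi F : plane R -> plane R)
    (E : set (plane R)) : set R :=
  rotation Psi F @` E.

Definition conv (R : realType) (A : set R) : set R :=
  smallest (fun B : set R^o => convex_set B) A.

Definition Sigma (R : realType) (Psi F : plane R -> plane R)
    (E : set (plane R)) : set int :=
  [set i | conv (rotation_set Psi F E) i%:~R].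

Definition nu (R : realType) (i : int) : plane R := (2 * pi * i%:~R, 0).
Arguments nu R i : clear implicits.

Record is_extension (R : realType) (Psi F : plane R -> plane R)
    (U : set (plane R)) (Fext : plane R -> plane R) : Prop := {
  extension_continuous : {within chalfplane R, continuous Fext};
  extension_periodic : angle_periodic (chalfplane R) Fext;
  extension_eq : forall y, polar_preim Psi (bd U) y -> Fext y = F y;
  extension_const : exists c, forall a, Fext (a, 0) = c }.

Definition Deg (R : realType) (Psi F : plane R -> plane R)
    (U : set (plane R)) (v : plane R) : int :=
  deg (descend Psi (xget (fun=> 0) [set Fext | is_extension Psi F U Fext])) U v.

(* Main.v *)
Require Import Defs.
From mathcomp Require Import all_boot all_order all_algebra.
From mathcomp Require Import all_classical all_reals all_analysis.
From mathcomp Require Import ring lra zify.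
Import Order.TTheory GRing.Theory Num.Theory.
Import numFieldNormedType.Exports.
Local Open Scope classical_set_scope.
Local Open Scope ring_scope.

(* On the boundary of U the map f_T is x |-> turn(x, a, e^c) - x, where turn rotates by the
   angle a and scales the radius by e^c in polar-like coordinates, and where H = (a, c) is
   read off the lift. Extending H continuously to the plane, the zeros of this map are the
   origin and the points where H = nu_i for some i, and the degree of H at nu_i is the
   degree D(F_T, U, nu_i), since (a, r (e^c - 1)) and (a, c) are linearly homotopic.

   Away from the origin both sides are compared zero by zero: H is perturbed to a
   continuous selection of finitely many affine maps in general position, so that H is
   affine and invertible near each of its finitely many relevant zeros z. Freezing the base
   point, the displacement becomes w |-> turn(z, w) - z after an invertible linear map, and
   the orientation of Psi says that this germ has degree 1. Precomposing a germ with a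
   linear map multiplies its degree by the sign of the determinant, whatever the germ.

   If 0 is in U, then H may be taken equal to a half turn near 0, which contributes 1. If i
   is not in Sigma, then a - 2 pi i has a constant sign on the boundary, and the degree of H
   at nu_i vanishes. *)

(** The degree is available only through its three axioms, so there is no product formula at hand,
    and [Psi] is merely continuous, so the degree of a displacement cannot be read off a Jacobian.
    This is why all perturbation takes place in H: near a zero the displacement is a fixed germ of
    [Psi] composed with a linear map, and only the linear factor needs computing. The logarithm of
    the radius makes this possible. Every continuous H from the plane to the plane defines a
    displacement, with no positivity to preserve, and H can be extended, cut off or approximated
    freely. The angle of a point is undefined at the origin, but [turn] fixes the origin for all
    parameters, so displacements remain continuous there. The half turn near the origin is chosen
    because pi is not an integer multiple of 2 pi: near the origin the displacement then vanishes at
    the origin only, and H takes none of the values nu_i. *)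

(* One pointwise notion for both [{within A, continuous f}] and, with [A = setT],
   [continuous f]. *)
Definition cont_in {X Y : topologicalType} (A : set X) (x : X) (f : X -> Y) :=
  f @ within A (nbhs x) --> f x.

Lemma within_cont_in {X Y : topologicalType} (A : set X) (f : X -> Y) :
  {within A, continuous f} <-> forall x, A x -> cont_in A x f.
Proof. exact: subspace_continuousP. Qed.

Lemma cont_inT {X Y : topologicalType} (x : X) (f : X -> Y) :
  cont_in setT x f <-> continuous_at x f.
Proof. by rewrite /cont_in withinET. Qed.

Lemma continuous_cont_in {X Y : topologicalType} (f : X -> Y) :
  continuous f <-> forall x, cont_in setT x f.
Proof. by split=> h x; apply/cont_inT. Qed.

Section ContIn.
Context {X : topologicalType} {A : set X} {x : X}.

Lemma cont_in_cst {Y : topologicalType} (c : Y) : cont_in A x (fun=> c).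
Proof. exact: cvg_cst. Qed.

Lemma cont_in_id : cont_in A x (fun y => y).
Proof. exact: cvg_within. Qed.

Lemma cont_in_at {Y : topologicalType} {f : X -> Y} : continuous_at x f -> cont_in A x f.
Proof. exact: cvg_within_filter. Qed.

Lemma cont_in_comp {Y Z : topologicalType} {f : X -> Y} {g : Y -> Z} :
  continuous_at (f x) g -> cont_in A x f -> cont_in A x (fun y => g (f y)).
Proof. by move=> cg cf; apply: (cvg_comp _ _ cf). Qed.

Lemma cont_in_comp_near {Y Z : topologicalType} {B : set Y} {f : X -> Y} {g : Y -> Z} :
  (\forall y \near x, A y -> B (f y)) -> cont_in B (f x) g -> cont_in A x f ->
  cont_in A x (fun y => g (f y)).
Proof.
move=> AB cg cf.
apply: (@cvg_comp _ _ _ f g _ (within B (nbhs (f x))) _ _ cg) => W nW.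
have : \forall y \near x, A y -> B (f y) -> W (f y) by exact: (cf _ nW).
by apply: filterS2 AB => y AB BW Ay; apply: BW => //; exact: AB.
Qed.

Lemma cont_in_comp_within {Y Z : topologicalType} {B : set Y} {f : X -> Y} {g : Y -> Z} :
  {homo f : y / A y >-> B y} -> cont_in B (f x) g -> cont_in A x f ->
  cont_in A x (fun y => g (f y)).
Proof. by move=> AB; apply: cont_in_comp_near; exact: filterE. Qed.

Lemma cont_in_fst {Y Z : topologicalType} {f : X -> Y * Z} :
  cont_in A x f -> cont_in A x (fun y => (f y).1).
Proof. by move=> cf; apply: (cont_in_comp (g := fst)) => //; exact: cvg_fst. Qed.

Lemma cont_in_snd {Y Z : topologicalType} {f : X -> Y * Z} :
  cont_in A x f -> cont_in A x (fun y => (f y).2).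
Proof. by move=> cf; apply: (cont_in_comp (g := snd)) => //; exact: cvg_snd. Qed.

Lemma cont_in_pair {Y Z : topologicalType} {f : X -> Y} {g : X -> Z} :
  cont_in A x f -> cont_in A x g -> cont_in A x (fun y => (f y, g y)).
Proof. by move=> cf cg; apply: cvg_pair. Qed.

Context {R : realType}.

Lemma cont_in_add {V : normedModType R} {f g : X -> V} : cont_in A x f -> cont_in A x g ->
  cont_in A x (fun y => f y + g y).
Proof. by move=> cf cg; apply: (@cvgD _ _ _ _ _ f g). Qed.

Lemma cont_in_opp {V : normedModType R} {f : X -> V} : cont_in A x f ->
  cont_in A x (fun y => - f y).
Proof. by move=> cf; apply: (@cvgN _ _ _ _ _ f). Qed.

Lemma cont_in_mul {f g : X -> R} : cont_in A x f -> cont_in A x g ->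
  cont_in A x (fun y => f y * g y).
Proof. by move=> cf cg; apply: (@cvgM _ _ _ _ f g). Qed.

Lemma cont_in_scale {V : normedModType R} {f : X -> R} {g : X -> V} :
  cont_in A x f -> cont_in A x g ->
  cont_in A x (fun y => f y *: g y).
Proof. by move=> cf cg; apply: (@cvgZ _ _ _ _ _ f g). Qed.

Lemma cont_in_inv {f : X -> R} : f x != 0 -> cont_in A x f ->
  cont_in A x (fun y => (f y)^-1).
Proof. by move=> f0 cf; apply: (@cvgV _ _ _ _ f). Qed.

Lemma cont_in_norm {V : normedModType R} {f : X -> V} : cont_in A x f ->
  cont_in A x (fun y => `|f y|).
Proof. by move=> cf; apply: (@cvg_norm _ _ _ _ _ f). Qed.

Lemma cont_in_expR {f : X -> R} : cont_in A x f ->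
  cont_in A x (fun y => expR (f y)).
Proof. by move=> cf; apply: cont_in_comp => //; exact: continuous_expR. Qed.

Lemma cont_in_ln {f : X -> R} : 0 < f x -> cont_in A x f ->
  cont_in A x (fun y => ln (f y)).
Proof. by move=> f0 cf; apply: cont_in_comp => //; exact: continuous_ln. Qed.

Lemma cont_in_max {f g : X -> R} : cont_in A x f -> cont_in A x g ->
  cont_in A x (fun y => Num.max (f y) (g y)).
Proof.
move=> cf cg.
rewrite (_ : (fun y => _) = fun y => 2^-1 * (f y + g y + `|f y - g y|)).
  apply: cont_in_mul (cont_in_cst _) _; apply: cont_in_add; first exact: cont_in_add.
  by apply/cont_in_norm/cont_in_add => //; exact: cont_in_opp.
by apply/funext => y; case: (lerP (f y) (g y)) => _; field.
Qed.

Lemma cont_in_min {f g : X -> R} : cont_in A x f -> cont_in A x g ->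
  cont_in A x (fun y => Num.min (f y) (g y)).
Proof.
move=> cf cg.
rewrite (_ : (fun y => _) = fun y => - Num.max (- f y) (- g y)).
  by apply/cont_in_opp/cont_in_max; exact: cont_in_opp.
by apply/funext => y; rewrite -oppr_min opprK.
Qed.

End ContIn.

Lemma cont_in_second {X Y Z : topologicalType} {A : set X} {B : set Y} {k : Y -> Z} {p : X * Y} :
  {within B, continuous k} -> (A `*` B) p ->
  cont_in (A `*` B) p (fun q : X * Y => k q.2).
Proof.
move=> /within_cont_in ck [_ Bp].
apply: (cont_in_comp_within (B := B)); [by case=> ? ? [] | exact: ck | exact: cont_in_snd cont_in_id].
Qed.

(** Recursion on the shape of the function. The leaves are closed by continuity facts found in the
    context, which is why such facts are often introduced just before a call; leaves that match no
    rule are left to the caller. *)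
Ltac cont_rec :=
  match goal with
  | H : cont_in _ ?x ?f |- cont_in _ ?x ?f => exact H
  | H : continuous_at ?x ?f |- cont_in _ ?x ?f => exact (cont_in_at H)
  | H : continuous ?f |- cont_in _ _ ?f => exact (cont_in_at (H _))
  | |- cont_in ?A ?x ?f => refine (proj1 (within_cont_in A f) _ x _); assumption
  | |- cont_in _ _ (fun _ => ?c) => exact (cont_in_cst c)
  | |- cont_in _ _ (fun y => y) => exact cont_in_id
  | |- cont_in _ _ (fun y => (@?f y, @?g y)) => refine (cont_in_pair (f := f) (g := g) _ _); cont_rec
  | |- cont_in _ _ (fun y => fst (@?f y)) => refine (cont_in_fst (f := f) _); cont_rec
  | |- cont_in _ _ (fun y => snd (@?f y)) => refine (cont_in_snd (f := f) _); cont_rec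
  | |- cont_in _ _ fst => exact (cont_in_fst cont_in_id)
  | |- cont_in _ _ snd => exact (cont_in_snd cont_in_id)
  | |- cont_in _ _ (fun y => @?f y + @?g y) => refine (cont_in_add (f := f) (g := g) _ _); cont_rec
  | |- cont_in _ _ (fun y => - @?f y) => refine (cont_in_opp (f := f) _); cont_rec
  | |- cont_in _ _ (fun y => @?f y * @?g y) => refine (cont_in_mul (f := f) (g := g) _ _); cont_rec
  | |- cont_in _ _ (fun y => @?f y *: @?g y) => refine (cont_in_scale (f := f) (g := g) _ _); cont_rec
  | |- cont_in _ _ (fun y => `| @?f y|) => refine (cont_in_norm (f := f) _); cont_rec
  | |- cont_in _ _ (fun y => expR (@?f y)) => refine (cont_in_expR (f := f) _); cont_rec
  | |- cont_in _ _ (fun y => Num.max (@?f y) (@?g y)) => refine (cont_in_max (f := f) (g := g) _ _); cont_rec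
  | |- cont_in _ _ (fun y => Num.min (@?f y) (@?g y)) => refine (cont_in_min (f := f) (g := g) _ _); cont_rec
  | H : continuous ?f |- cont_in _ _ (fun y => ?f (@?g y)) =>
      refine (cont_in_comp (f := g) (g := f) (H _) _); cont_rec
  | _ => idtac
  end.
Ltac cont :=
  lazymatch goal with
  | |- cont_in _ _ _ => idtac
  | |- continuous_at _ _ => apply/cont_inT
  | |- _ => first [apply/within_cont_in => ? ? | apply/continuous_cont_in => ?]
  end; rewrite /=; cont_rec; rewrite /=; try done.

(** * Consequences of the axioms of the degree *)

Lemma in01 (R : realType) (t : R) : `[0, 1]%classic t <-> 0 <= t <= 1.
Proof. by rewrite /= in_itv. Qed.

Section PlaneTopology.
Context {R : realType}.
Implicit Types (U : set (plane R)) (x z : plane R).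

Lemma plane_norm x : `|x| = Num.max `|x.1| `|x.2|.
Proof. exact: prod_normE. Qed.

Lemma plane_norm_ltr x (e : R) : (`|x| < e) = (`|x.1| < e) && (`|x.2| < e).
Proof. by rewrite plane_norm gt_max. Qed.

Lemma plane_norm_ler x (e : R) : (`|x| <= e) = (`|x.1| <= e) && (`|x.2| <= e).
Proof. by rewrite plane_norm ge_max. Qed.

Lemma plane_dist_ltr x z (e : R) :
  (`|x - z| < e) = (`|x.1 - z.1| < e) && (`|x.2 - z.2| < e).
Proof. exact: plane_norm_ltr. Qed.

Lemma plane_dist_ler x z (e : R) :
  (`|x - z| <= e) = (`|x.1 - z.1| <= e) && (`|x.2 - z.2| <= e).
Proof. exact: plane_norm_ler. Qed.

Lemma plane_scale (k : R) x : k *: x = (k * x.1, k * x.2).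
Proof. by []. Qed.

Lemma bdP U x : open U -> bd U x <-> closure U x /\ ~ U x.
Proof. by move=> /interior_id oU; rewrite /bd oU. Qed.

Lemma plane_ballP x (e : R) z : ball x e z <-> `|z - x| < e.
Proof. by rewrite -ball_normE /= distrC. Qed.

Lemma closure_norm_le U x (e : R) z :
  (forall y, U y -> `|y - x| <= e) -> closure U z -> `|z - x| <= e.
Proof.
move=> hU; pose B := [set z : plane R | `|z - x| <= e].
suff cB : closed B by move=> cz; apply: cB; apply: closure_subset cz.
have -> : B = (fun z => `|z - x|) @^-1` [set r : R | r <= e] by [].
by apply: closed_comp; [move=> y _; cont | exact: closed_le].
Qed.

Lemma closure_ball_norm x (e : R) z : closure (ball x e) z -> `|z - x| <= e.
Proof. by apply: closure_norm_le => y /plane_ballP/ltW. Qed.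

Lemma bounded_setP U : bounded_set U <-> exists M : R, forall x, U x -> `|x| <= M.
Proof.
split; first by case=> M [_ hM]; exists (M + 1) => x Ux; apply: hM => //; rewrite ltrDl.
case=> M hM; exists M; split; first exact: num_real.
by move=> N MN x /hM h; apply: le_trans h (ltW MN).
Qed.

Lemma bounded_closure U : bounded_set U -> bounded_set (closure U).
Proof.
move=> /bounded_setP[M hM]; apply/bounded_setP; exists M => x cx.
rewrite -(subr0 x); apply: closure_norm_le cx => y Uy; rewrite subr0; exact: hM.
Qed.

Lemma bounded_subset U V : U `<=` V -> bounded_set V -> bounded_set U.
Proof. by move=> UV /bounded_setP[M hM]; apply/bounded_setP; exists M => x /UV/hM. Qed.

Lemma bounded_ball x (e : R) : bounded_set (ball x e).
Proof.
apply/bounded_setP; exists (e + `|x|) => y /plane_ballP/ltW xy.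
by rewrite -(subrK x y) (le_trans (ler_normD _ _))// lerD2r.
Qed.

Lemma compact_plane (K : set (plane R)) : closed K -> bounded_set K -> compact K.
Proof.
move=> cK /bounded_setP[M hM].
apply: (@subclosed_compact _ _ (`[- M, M]%classic `*` `[- M, M]%classic)) => //.
  by apply: compact_setX; exact: segment_compact.
by move=> x /hM; rewrite plane_norm_ler !ler_norml /= !in_itv /= => /andP[].
Qed.

Lemma compact_closure U : bounded_set U -> compact (closure U).
Proof. by move=> /bounded_closure; apply: compact_plane; exact: closed_closure. Qed.

Lemma compact_bd U : bounded_set U -> compact (bd U).
Proof.
move=> bU; apply: (@subclosed_compact _ (bd U) (closure U)); last by move=> x [].
  rewrite /bd setDE; apply: closedI; first exact: closed_closure.
  by apply: open_closedC; exact: open_interior.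
exact: compact_closure.
Qed.

Lemma compact_image_bounded {f : plane R -> plane R} (K : set (plane R)) :
  compact K -> {within K, continuous f} -> exists M : R, forall x, K x -> `|f x| <= M.
Proof.
move=> cK cf; have /compact_bounded/bounded_setP[M hM] := continuous_compact cf cK.
by exists M => x Kx; apply: hM; exists x.
Qed.

End PlaneTopology.

Section Degree.
Context {R : realType} {d : (plane R -> plane R) -> set (plane R) -> plane R -> int}.
Hypothesis hd : brouwer_degree d.
Implicit Types (f g : plane R -> plane R) (U : set (plane R)) (v x : plane R).

(** Additivity with all three sets empty reads n = n + n. *)
Let deg0 g v : d g set0 v = 0.
Proof.
apply: (addrI (d g set0 v)); rewrite addr0; apply/esym.
apply: (brouwer_additivity hd) => //; try exact: open0.
- by apply/bounded_setP; exists 0.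
- rewrite closure0; exact: continuous_subspace0.
- by rewrite setI0.
- by rewrite closure0.
Qed.

Lemma deg_excision {g U} U1 v : open U -> bounded_set U -> {within closure U, continuous g} ->
  open U1 -> U1 `<=` U -> (forall x, closure U x -> ~ U1 x -> g x <> v) ->
  d g U v = d g U1 v.
Proof.
move=> oU bU cg oU1 U1U h.
rewrite (brouwer_additivity hd oU bU cg oU1 open0) ?deg0 ?addr0 ?setI0 //.
by rewrite setU0.
Qed.

Lemma deg_none {g U} v : open U -> bounded_set U -> {within closure U, continuous g} ->
  (forall x, closure U x -> g x <> v) -> d g U v = 0.
Proof.
move=> oU bU cg h; rewrite (deg_excision set0) ?deg0 //; by move=> x /h.
Qed.

Lemma deg_homotopy (h : R -> plane R -> plane R) U v : open U -> bounded_set U ->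
  {within `[0, 1]%classic `*` closure U, continuous (fun p : R * plane R => h p.1 p.2)} ->
  (forall t x, 0 <= t <= 1 -> bd U x -> h t x <> v) ->
  d (h 0) U v = d (h 1) U v.
Proof.
move=> oU bU ch hv; apply/esym.
apply: (brouwer_homotopy hd (h := h) (v := fun=> v)) => //.
- by apply/within_cont_in => t _; exact: cont_in_cst.
- by apply/in01; rewrite ler01 lexx.
Qed.

Lemma deg_segment f g U v : open U -> bounded_set U ->
  {within closure U, continuous f} -> {within closure U, continuous g} ->
  (forall t x, 0 <= t <= 1 -> bd U x -> (1 - t) *: f x + t *: g x <> v) ->
  d f U v = d g U v.
Proof.
move=> oU bU cf cg h.
pose H (t : R) x := (1 - t) *: f x + t *: g x.
have -> : f = H 0 by apply/funext => x; rewrite /H subr0 scale1r scale0r addr0.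
have -> : g = H 1 by apply/funext => x; rewrite /H subrr scale1r scale0r add0r.
apply: deg_homotopy => //; rewrite /H; apply/within_cont_in => p hp.
have {}cf := cont_in_second cf hp; have {}cg := cont_in_second cg hp.
by cont.
Qed.

Lemma deg_bd_eq f g U v : open U -> bounded_set U ->
  {within closure U, continuous f} -> {within closure U, continuous g} ->
  (forall x, bd U x -> f x = g x) -> (forall x, bd U x -> f x <> v) ->
  d f U v = d g U v.
Proof.
move=> oU bU cf cg fg fv; apply: deg_segment => // t x _ bx.
by rewrite -(fg _ bx) -scalerDl subrK scale1r; exact: fv.
Qed.

(** The homotopy axiom lets the target move: t v is subtracted from the map and from the target at
    once, so the condition on the boundary is the same for all t. *)
Lemma deg_translate g U v : open U -> bounded_set U -> {within closure U, continuous g} ->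
  (forall x, bd U x -> g x <> v) -> d g U v = d (fun x => g x - v) U 0.
Proof.
move=> oU bU cg gv.
pose h (t : R) x := g x - t *: v.
have e t : 0 <= t <= 1 -> d (h t) U (v - t *: v) = d (h 0) U (v - 0 *: v).
  move=> t01; apply: (brouwer_homotopy hd (h := h) (v := fun t => v - t *: v)) => //.
  - apply/within_cont_in => p hp; have {}cg := cont_in_second cg hp.
    by rewrite /h; cont.
  - by cont.
  - by move=> s x _ bx /addIr; exact: gv.
have := e 1; rewrite lexx ler01 scale1r scale0r subr0 subrr => /(_ isT).
have -> : h 0 = g by apply/funext => x; rewrite /h scale0r subr0.
by have -> : h 1 = fun x => g x - v by apply/funext => x; rewrite /h scale1r.
Qed.

Lemma deg_eq_closure f g U v : open U -> bounded_set U ->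
  {within closure U, continuous f} ->
  (forall x, closure U x -> f x = g x) -> (forall x, bd U x -> f x <> v) ->
  d f U v = d g U v.
Proof.
move=> oU bU cf fg fv; apply: deg_bd_eq => //; last by move=> x [/fg].
by apply: subspace_eq_continuous cf => x /set_mem /fg.
Qed.

End Degree.

(* Without a Brouwer degree [deg] would vanish identically, against the orientation axiom. *)
Lemma brouwer_degree_deg {R : realType} {Psi : plane R -> plane R} :
  polar_coordinates Psi -> brouwer_degree (@deg R).
Proof.
move=> hPsi; rewrite /deg; case: xgetP => [d _ //|] nd.
exfalso.
have [V [oV V1 VA _ [cP [q [_ qP]]]]] := polar_local_homeo hPsi (y := (0, 1)) (@ltr01 R).
have := open_nbhs_nbhs (conj oV V1) => /nbhs_ballP[e /= e0 eV].
have sub : closure (ball (0 : R, 1 : R) (e / 2)) `<=` V.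
  move=> z /closure_ball_norm hz; apply: eV; apply/plane_ballP.
  by apply: le_lt_trans hz _; lra.
have := polar_orientation hPsi (V := ball (0 : R, 1 : R) (e / 2)) (y := (0 , 1)).
rewrite /deg xgetPN //.
have -> : (0 : int) = 1 <-> False by [].
apply=> //.
- exact: ball_open.
- exact: bounded_ball.
- exact: subset_trans sub VA.
- by apply: ballxx; lra.
- exact: continuous_subspaceW sub cP.
- move=> x y /set_mem/sub Vx /set_mem/sub Vy xy.
  by rewrite -(qP x) // xy qP.
Qed.

(** * The index of an isolated zero *)

Definition lin {R : realType} (a b c e : R) (w : plane R) : plane R :=
  (a * w.1 + b * w.2, c * w.1 + e * w.2).

Lemma continuous_lin {R : realType} (a b c e : R) : continuous (lin a b c e).
Proof. by rewrite /lin; cont. Qed.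

Lemma plane_eq {R : realType} (w z : plane R) : w.1 = z.1 -> w.2 = z.2 -> w = z.
Proof. by case: w z => ? ? [? ?] /= -> ->. Qed.

Lemma lin_eq0 {R : realType} (a b c e : R) w : a * e - b * c != 0 -> lin a b c e w = 0 -> w = 0.
Proof.
move=> D0 [h1 h2]; apply: plane_eq; apply/eqP.
  have : (a * e - b * c) * w.1 = 0.
    by transitivity (e * (a * w.1 + b * w.2) - b * (c * w.1 + e * w.2));
      [ring | rewrite h1 h2; ring].
  by move/eqP; rewrite mulf_eq0 (negbTE D0).
have : (a * e - b * c) * w.2 = 0.
  by transitivity (a * (c * w.1 + e * w.2) - c * (a * w.1 + b * w.2));
    [ring | rewrite h1 h2; ring].
by move/eqP; rewrite mulf_eq0 (negbTE D0).
Qed.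

Lemma convex_gt0 {R : realType} {t x y : R} : 0 <= t <= 1 -> 0 < x -> 0 < y ->
  0 < (1 - t) * x + t * y.
Proof. by move=> /andP[t0 t1] x0 y0; case: (lerP t (1 / 2)) => h; nra. Qed.

Section Index.
Context {R : realType} {d : (plane R -> plane R) -> set (plane R) -> plane R -> int}.
Hypothesis hd : brouwer_degree d.
Implicit Types (P Q : plane R -> plane R) (U W : set (plane R)) (v x w z : plane R).

Local Notation B r := (ball (0 : plane R) r).
Local Notation ind P := (d P (B 1) 0).

(** Since P vanishes nowhere else in the plane, excision replaces W by a ball that contains W, the
    unit ball and the segment from 0 to z; in that ball the zero slides from z to 0. *)
Lemma deg_single_zero {P W z} : continuous P -> (forall w, P w = 0 -> w = 0) ->
  open W -> bounded_set W -> W z -> d (fun x => P (x - z)) W 0 = ind P.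
Proof.
move=> cP P0 oW bW Wz; have /bounded_setP[M hM] := bW.
pose r := M + 2 + `|z|.
have M0 : 0 <= M by apply: le_trans (hM _ Wz).
have zr : `|z| < r by rewrite /r; lra.
have cc z' : {within closure (B r), continuous (fun x => P (x - z'))}.
  by apply: continuous_subspaceT; cont.
rewrite -(deg_excision hd (U := B r)) //; first last.
- by move=> x _ nW /P0/subr0_eq xz; apply: nW; rewrite xz.
- move=> x /hM h; apply/plane_ballP; rewrite subr0 /r.
  by have := normr_ge0 z; lra.
- exact: bounded_ball.
- exact: ball_open.
rewrite -(deg_excision hd (U := B r) (B 1)) //; first last.
- by move=> x _ nB /P0 x0; apply: nB; rewrite x0; exact: ballxx.
- by apply: le_ball; rewrite /r; have := normr_ge0 z; lra.
- exact: ball_open.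
- exact: continuous_subspaceT.
- exact: bounded_ball.
- exact: ball_open.
have := deg_homotopy hd (fun t x => P (x - t *: z)) (B r) 0.
have -> : (fun x => P (x - 0 *: z)) = P by apply/funext => x; rewrite scale0r subr0.
rewrite scale1r => -> //.
- exact: ball_open.
- exact: bounded_ball.
- by apply: continuous_subspaceT; cont.
- move=> t x /andP[t0 t1] /(bdP _ _ (ball_open _ _))[_ nB] /P0/subr0_eq xz.
  apply: nB; apply/plane_ballP; rewrite subr0 xz normrZ ger0_norm //.
  by apply: le_lt_trans zr; rewrite ler_piMl.
Qed.

Lemma ind_homotopy (h : R -> plane R -> plane R) :
  continuous (fun p : R * plane R => h p.1 p.2) ->
  (forall t w, 0 <= t <= 1 -> h t w = 0 -> w = 0) ->
  ind (h 0) = ind (h 1).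
Proof.
move=> ch h0; apply: (deg_homotopy hd).
- exact: ball_open.
- exact: bounded_ball.
- exact: continuous_subspaceT.
- move=> t x t01 /(bdP _ _ (ball_open _ _))[_ nB] /(h0 _ _ t01) x0.
  by apply: nB; rewrite x0; exact: ballxx.
Qed.

(** * Precomposition of a germ with linear maps *)

Section Linear.
Context {Q : plane R -> plane R} (cQ : continuous Q) (Q0 : forall w, Q w = 0 -> w = 0).

Lemma ind_lin_segment (a b c e a' b' c' e' : R) :
  (forall t, 0 <= t <= 1 ->
    ((1 - t) * a + t * a') * ((1 - t) * e + t * e') -
    ((1 - t) * b + t * b') * ((1 - t) * c + t * c') != 0) ->
  ind (Q \o lin a b c e) = ind (Q \o lin a' b' c' e').
Proof.
move=> D0.
pose h t w := Q (lin ((1 - t) * a + t * a') ((1 - t) * b + t * b')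
                     ((1 - t) * c + t * c') ((1 - t) * e + t * e') w).
have -> : Q \o lin a b c e = h 0.
  by apply/funext => w; rewrite /h /= !subr0 !mul1r !mul0r !addr0.
have -> : Q \o lin a' b' c' e' = h 1.
  by apply/funext => w; rewrite /h /= !subrr !mul1r !mul0r !add0r.
apply: ind_homotopy; first by rewrite /h /lin; cont.
by move=> t w /D0 Dt /Q0; exact: lin_eq0.
Qed.

(** The new matrix is the old one times a quarter turn J, and the segment from the identity to J
    stays invertible, with determinant (1 - t)^2 + t^2. *)
Lemma ind_lin_rot (a b c e : R) : a * e - b * c != 0 ->
  ind (Q \o lin a b c e) = ind (Q \o lin b (- a) e (- c)).
Proof.
move=> D0; apply: ind_lin_segment => t t01.
have -> : ((1 - t) * a + t * b) * ((1 - t) * e + t * - c) -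
  ((1 - t) * b + t * - a) * ((1 - t) * c + t * e) =
  ((1 - t) ^+ 2 + t ^+ 2) * (a * e - b * c) by ring.
(* Twice the first factor is (2 t - 1)^2 + 1. *)
by rewrite mulf_neq0 // lt0r_neq0 //; move: (sqr_ge0 (2 * t - 1)); rewrite !expr2; lra.
Qed.

(** Gaussian elimination by homotopies: clearing b and then c keeps the determinant equal to D, and
    the diagonal (a, D / a) is deformed to (1, sg D) without a change of sign. *)
Let ind_lin_pos (a b c e : R) : 0 < a -> a * e - b * c != 0 ->
  ind (Q \o lin a b c e) = ind (Q \o lin 1 0 0 (Num.sg (a * e - b * c))).
Proof.
move=> a0 D0; set D := a * e - b * c in D0 *.
transitivity (ind (Q \o lin a 0 c (D / a))).
  apply: ind_lin_segment => t t01.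
  suff -> : ((1 - t) * a + t * a) * ((1 - t) * e + t * (D / a)) -
    ((1 - t) * b + t * 0) * ((1 - t) * c + t * c) = D by [].
  by rewrite /D; field; exact: lt0r_neq0.
transitivity (ind (Q \o lin a 0 0 (D / a))).
  apply: ind_lin_segment => t t01.
  suff -> : ((1 - t) * a + t * a) * ((1 - t) * (D / a) + t * (D / a)) -
    ((1 - t) * 0 + t * 0) * ((1 - t) * c + t * 0) = D by [].
  by rewrite /D; field; exact: lt0r_neq0.
apply: ind_lin_segment => t t01.
rewrite !mulr0 addr0 mul0r subr0 mulf_neq0 //; first by rewrite lt0r_neq0 ?convex_gt0.
have aV : 0 < a^-1 by rewrite invr_gt0.
case: (ltgtP D 0) D0 => // Ds _.
  have Dn : 0 < - (D / a) by rewrite -mulNr mulr_gt0 ?oppr_gt0.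
  by rewrite ?(ltr0_sg Ds) ltr0_neq0 //; have := convex_gt0 t01 Dn ltr01; lra.
by rewrite ?(gtr0_sg Ds) lt0r_neq0 // convex_gt0 // mulr_gt0.
Qed.

(** Quarter turns reduce to a positive corner entry: two of them negate the matrix, and if a = 0 one
    of them moves b, which is then nonzero, into the corner. *)
Lemma ind_lin_sg (a b c e : R) : a * e - b * c != 0 ->
  ind (Q \o lin a b c e) = ind (Q \o lin 1 0 0 (Num.sg (a * e - b * c))).
Proof.
have neg a' b' c' e' : a' < 0 -> a' * e' - b' * c' != 0 ->
    ind (Q \o lin a' b' c' e') = ind (Q \o lin 1 0 0 (Num.sg (a' * e' - b' * c'))).
  move=> a0 D0; rewrite ind_lin_rot // ind_lin_rot; last by rewrite -[_ - _]/(b' * - c' - - a' * e'); move: D0; congr (_ != _); ring.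
  rewrite ind_lin_pos ?oppr_gt0 //; last by move: D0; congr (_ != _); ring.
  by congr (ind (Q \o lin 1 0 0 (Num.sg _))); ring.
move=> D0; case: (ltgtP a 0) => a0; [exact: neg | exact: ind_lin_pos |].
have D' : b * - c - - a * e = a * e - b * c by ring.
rewrite ind_lin_rot // -D'; rewrite -D' in D0.
case: (ltgtP b 0) => b0; [exact: neg | exact: ind_lin_pos |].
by move: D0; rewrite a0 b0 oppr0 !mul0r subr0 eqxx.
Qed.

(* The fold [x |-> (x.1, |x.2| - 1)] has total degree 0, and its zeros (0, 1) and (0, -1)
   contribute the identity and the reflection. *)
Lemma ind_reflection : ind (Q \o lin 1 0 0 (-1)) = - ind Q.
Proof.
pose f t (x : plane R) := Q (x.1, `|x.2| - 1 + 2 * t).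
have cf : continuous (fun p : R * plane R => f p.1 p.2) by rewrite /f; cont.
have cft t : continuous (f t) by rewrite /f; cont.
have oB x (r : R) : open (ball (x : plane R) r) by exact: ball_open.
have bB x (r : R) : bounded_set (ball (x : plane R) r) by exact: bounded_ball.
pose p : plane R := (0, 1); pose q : plane R := (0, -1).
have fE x : f 0 x = Q (x.1, `|x.2| - 1) by rewrite /f mulr0 addr0.
have sub3 (s : R) : `|s| <= 1 -> ball ((0, s) : plane R) 1 `<=` B 3.
  move=> s1 x /plane_ballP; rewrite plane_dist_ltr /= => /andP[x1 x2].
  apply/plane_ballP; rewrite plane_dist_ltr !subr0; rewrite subr0 in x1.
  by have := ler_normD (x.2 - s) s; rewrite subrK => h; apply/andP; split; lra.
have : d (f 0) (B 3) 0 = d (f 0) (ball p 1) 0 + d (f 0) (ball q 1) 0.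
  apply: (brouwer_additivity hd) => //.
  - exact: continuous_subspaceT.
  - by apply: sub3; rewrite normr1.
  - by apply: sub3; rewrite normrN1.
  - rewrite -subset0 => x [/plane_ballP + /plane_ballP].
    rewrite !plane_dist_ltr /p /q /= => /andP[_ +] /andP[_ +]; rewrite opprK !ltr_norml => /andP[? ?] /andP[? ?]; exfalso; lra.
  - move=> x _ nx; rewrite fE => /Q0 [x1 x2]; apply: nx.
    have : `|x.2| = 1 by lra.
    have [x0|x0] := ger0P x.2 => x2'; [left | right]; apply/plane_ballP;
    rewrite plane_dist_ltr /p /q /= x1 subr0 normr0 ltr01 /= ltr_norml; apply/andP; split; lra.
(* Raising the fold by 2 leaves no zero, as the second coordinate becomes |x.2| + 1. On the way the
   zeros satisfy |x.2| = 1 - 2 t, so they never reach the boundary of the ball of radius 3. *)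
have tot : d (f 0) (B 3) 0 = 0.
  rewrite (deg_homotopy hd) //; last 2 first.
  - exact: continuous_subspaceT.
  - move=> t x /andP[t0 t1] /(bdP _ _ (ball_open _ _))[_ nB] /Q0 [x1 x2].
    apply: nB; apply/plane_ballP; rewrite subr0 plane_norm_ltr x1 normr0 ltr0n /=.
    by lra.
  apply: (deg_none hd) => //; first exact: continuous_subspaceT.
  by move=> x _ /Q0 [_]; have := normr_ge0 x.2; lra.
rewrite tot.
have -> : d (f 0) (ball p 1) 0 = ind Q.
  rewrite -(deg_single_zero cQ Q0 (W := ball p 1) (z := p)) //; last exact: ballxx.
  apply: (deg_eq_closure hd) => //; first exact: continuous_subspaceT.
  - move=> x /closure_ball_norm; rewrite fE plane_dist_ler /p /q /= => /andP[_].
    rewrite ler_norml => /andP[h1 h2]; rewrite ger0_norm ?subr0; last by lra.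
    by congr Q; apply: plane_eq; rewrite /p /q /=; rewrite ?subr0.
  - move=> x /(bdP _ _ (ball_open _ _))[/closure_ball_norm]; rewrite plane_dist_ler fE /p /q /=.
    move=> /andP[_]; rewrite ler_norml => /andP[h1 h2] + /Q0 [x1]; apply: contra_not.
    rewrite ger0_norm; last by lra.
    move=> x2; apply/plane_ballP.
    by rewrite plane_dist_ltr /p /q /= x1 x2 subr0 normr0 ltr01.
have -> : d (f 0) (ball q 1) 0 = ind (Q \o lin 1 0 0 (-1)).
  pose P w := Q (lin 1 0 0 (-1) w).
  have cP : continuous P by rewrite /P /lin; cont.
  have P0 w : P w = 0 -> w = 0.
    by move=> /Q0; apply: lin_eq0; rewrite mul0r subr0 mul1r oppr_eq0 oner_neq0.
  rewrite -(deg_single_zero cP P0 (W := ball q 1) (z := q)) //; last exact: ballxx.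
  apply: (deg_eq_closure hd) => //; first exact: continuous_subspaceT.
  - move=> x /closure_ball_norm; rewrite fE plane_dist_ler /p /q /= => /andP[_].
    rewrite opprK ler_norml => /andP[h1 h2]; rewrite ler0_norm /P /lin /=; last by lra.
    by congr Q; apply: plane_eq; rewrite /p /q /=; ring.
  - move=> x /(bdP _ _ (ball_open _ _))[/closure_ball_norm]; rewrite plane_dist_ler fE /p /q /=.
    move=> /andP[_]; rewrite opprK ler_norml => /andP[h1 h2] + /Q0 [x1]; apply: contra_not.
    rewrite ler0_norm; last by lra.
    move=> x2; apply/plane_ballP.
    rewrite plane_dist_ltr /p /q /= x1 subr0 normr0 ltr01 /= opprK ltr_norml; apply/andP; split; lra.
by move=> /eqP; rewrite eq_sym addr_eq0 => /eqP->; rewrite opprK.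
Qed.

End Linear.
End Index.

(** * Generic piecewise affine approximation *)

Section PiecewiseAffine.
Context {R : realType}.
Implicit Types (l w : R * R * R) (s : seq (R * R * R)) (x y v p : plane R).
Implicit Types (g h : plane R -> R) (K : set (plane R)).

(* [(a, b, c)] encodes the affine function [x |-> a x.1 + b x.2 + c]. *)
Definition affine l x : R := l.1.1 * x.1 + l.1.2 * x.2 + l.2.

Lemma continuous_affine l : continuous (affine l).
Proof. by rewrite /affine; cont. Qed.

(** A continuous selection from a finite family. No subdivision of the plane is recorded: the
    selection can switch only where two members of the family agree. *)
Definition piecewise_affine g :=
  continuous g /\ exists s, forall x, exists2 l, l \in s & g x = affine l x.

Lemma pa_affine l : piecewise_affine (affine l).
Proof.
split; first exact: continuous_affine.
by exists [:: l] => x; exists l; rewrite ?mem_head.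
Qed.

Lemma pa_max g h : piecewise_affine g -> piecewise_affine h ->
  piecewise_affine (fun x => Num.max (g x) (h x)).
Proof.
move=> [cg [s1 gs]] [ch [s2 hs]]; split; first by cont.
exists (s1 ++ s2) => x; have [l ls ->] := gs x; have [l' ls' ->] := hs x.
case: (lerP (affine l x) (affine l' x)) => _; [exists l' | exists l] => //;
by rewrite mem_cat ?ls ?ls' ?orbT.
Qed.

Lemma pa_scale_add (k c : R) g : piecewise_affine g -> piecewise_affine (fun x => k * g x + c).
Proof.
move=> [cg [s gs]]; split; first by cont.
exists [seq (k * l.1.1, k * l.1.2, k * l.2 + c) | l : R * R * R <- s] => x.
have [l ls ->] := gs x; exists (k * l.1.1, k * l.1.2, k * l.2 + c).
  by apply/mapP; exists l.
by rewrite /affine /=; ring.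
Qed.

(** The norm of the plane is the sup norm, hence a maximum of four affine functions. *)
Lemma pa_dist v : piecewise_affine (fun x => `|x - v|).
Proof.
have E x : `|x - v| =
    Num.max (Num.max (affine (1, 0, - v.1) x) (affine (-1, 0, v.1) x))
            (Num.max (affine (0, 1, - v.2) x) (affine (0, -1, v.2) x)).
  rewrite plane_norm /affine /=.
  have N (r : R) : `|r| = Num.max r (- r) by case: (ger0P r) => h; case: lerP => //; lra.
  by rewrite !N; congr Num.max; congr Num.max; ring.
rewrite (funext E).
by do ![apply: pa_max || apply: pa_affine].
Qed.

Lemma pa_seq_max (I : eqType) (T : I -> plane R -> R) (r : seq I) : r != [::] ->
  (forall i, piecewise_affine (T i)) ->
  exists g, [/\ piecewise_affine g, forall i x, i \in r -> T i x <= g x &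
    forall x, exists2 i, i \in r & g x = T i x].
Proof.
move=> r0 paT; elim: r r0 => // i [_ _|j r /(_ isT) [g [pg gT gE]] _].
  exists (T i); split=> // [k x|x]; first by rewrite inE => /eqP->.
  by exists i; rewrite ?mem_head.
exists (fun x => Num.max (T i x) (g x)); split; first exact: pa_max.
  move=> k x; rewrite inE => /predU1P[->|/gT h]; first by rewrite le_max lexx.
  by rewrite le_max h orbT.
move=> x; case: (lerP (T i x) (g x)) => _; last by exists i; rewrite ?mem_head.
by have [k kr ->] := gE x; exists k => //; rewrite inE kr orbT.
Qed.

Lemma uniform_on_compact h K (e : R) : continuous h -> compact K -> 0 < e ->
  exists2 dl, 0 < dl & forall x y, K x -> `|x - y| < dl -> `|h x - h y| < e.
Proof.
move=> ch /compact_near_coveringP cK e0.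
have near_x x : K x -> \forall x' \near x & dl \near (0 : R)^'+,
    forall y, `|x' - y| < dl -> `|h x' - h y| < e.
  move=> Kx; have /cvgrPdist_lt /(_ (e / 2)) : h @ x --> h x by exact: ch.
  rewrite divr_gt0 // => /(_ isT) /nbhs_ballP [r /= r0 hr].
  exists (ball x (r / 2), [set dl : R | dl < r / 2]).
    split => /=; first by apply: nbhsx_ballx; rewrite divr_gt0.
    by apply: nbhs_right_lt; rewrite divr_gt0.
  move=> [x' dl] /= [xx' dlr] y x'y.
  have h1 : `|h x - h x'| < e / 2.
    by apply: hr; apply: le_ball xx'; rewrite ler_pdivrMr // ler_pMr // ler1n.
  have h2 : `|h x - h y| < e / 2.
    apply: hr; apply/plane_ballP; move/plane_ballP: xx' => xx'.
    have := ler_distD x' y x; rewrite (distrC y x'); lra.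
  have := ler_distD (h x) (h x') (h y); rewrite (distrC (h x') (h x)); lra.
have := cK _ _ _ _ near_x => /(_ _) near_K.
have [dl [dl0 hdl]] : exists dl : R, 0 < dl /\ K `<=` fun x => forall y, `|x - y| < dl -> `|h x - h y| < e.
  near (0 : R)^'+ => dl; exists dl; split; first by near: dl; exact: nbhs_right_gt.
  by near: dl; exact: near_K.
by exists dl => // x y Kx; exact: hdl.
Unshelve. all: end_near. Qed.

Lemma finite_net K (r : R) : compact K -> 0 < r ->
  exists2 s : seq (plane R), forall v, v \in s -> K v &
    forall x, K x -> exists2 v, v \in s & `|x - v| < r.
Proof.
move=> /compact_near_coveringP cK r0.
(* Finite lists directed by inclusion: a property holds eventually if it holds for all lists that
   contain a given one. Compactness then yields one list for all of K. *)
pose F := filter_from setT (fun s0 : seq (plane R) => [set s : seq (plane R) | {subset s0 <= s}]).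
have FF : Filter F.
  apply: filter_from_filter; first by exists [::].
  move=> s t _ _; exists (s ++ t) => // u /= stu.
  by split=> x xs; apply: stu; rewrite mem_cat xs ?orbT.
have [|s _ sP] := cK _ F (fun (s : seq (plane R)) x => exists2 v, v \in s /\ K v & `|x - v| < r) FF.
  move=> x Kx; exists (ball x r, [set s : seq (plane R) | {subset [:: x] <= s}]).
    by split; [exact: nbhsx_ballx | exists [:: x]].
  move=> [x' s] /= [/plane_ballP xx' xs]; exists x => //.
  by split=> //; apply: xs; rewrite mem_head.
exists [seq v <- s | `[< K v >] ] => [v|x Kx]; first by rewrite mem_filter => /andP[/asboolP].
have [|v [vs Kv] xv] := sP s _ x Kx; first by [].
by exists v; rewrite // mem_filter vs andbT; exact/asboolP.
Qed.

(* The tents [h v - C |x - v|], for [v] in a finite net and [C] large. *)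
Lemma pa_dense h K (e : R) : continuous h -> compact K -> 0 < e ->
  exists2 g, piecewise_affine g & forall x, K x -> `|g x - h x| < e.
Proof.
move=> ch cK e0.
have e20 : 0 < e / 2 by rewrite divr_gt0.
have [dl dl0 hdl] := uniform_on_compact h K (e / 2) ch cK e20.
have [|M hM] := @compact_image_bounded R (fun x => (h x, 0)) K cK.
  by cont.
have {}hM x : K x -> `|h x| <= M.
  by move=> /hM; rewrite plane_norm_ler => /andP[].
(* C dl exceeds 2 |M|, so a tent whose apex is at distance dl or more from x lies below h x; the
   nearer apexes have height within e / 2 of h x. The mesh e / 2 / C ensures that some tent loses
   less than e / 2 at x. *)
pose C := 2 * `|M| / dl + 1.
have C0 : 0 < C by rewrite /C ltr_pwDr // divr_ge0 ?mulr_ge0 // ltW.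
have eC : 0 < e / 2 / C by rewrite divr_gt0.
have [|s sK hs] := finite_net K (Num.min dl (e / 2 / C)) cK.
  by rewrite lt_min dl0.
case: (pselect (exists x, K x)) => [[x0 Kx0]|nK]; last first.
  by exists (affine (0, 0, 0)); [exact: pa_affine | move=> x Kx; case: nK; exists x].
have s0 : s != [::] by have [v] := hs _ Kx0; case: (s).
have [v|g [pg gT gE]] := pa_seq_max (plane R) (fun v x => - C * `|x - v| + h v) s s0.
  exact/pa_scale_add/pa_dist.
exists g => // x Kx; rewrite ltr_norml; apply/andP; split.
  have [v vs] := hs _ Kx; rewrite lt_min => /andP[xdl xC]; have := gT v x vs.
  have := hdl x v Kx xdl; rewrite ltr_norml => /andP[].
  have : C * `|x - v| < e / 2 by rewrite mulrC -ltr_pdivlMr.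
  by rewrite mulNr; lra.
have [v vs ->] := gE x.
have xv0 := normr_ge0 (x - v).
case: (ltP `|x - v| dl) => xdl.
  have := hdl x v Kx xdl; rewrite ltr_norml => /andP[].
  have : 0 <= C * `|x - v| by rewrite mulr_ge0 // ltW.
  by rewrite mulNr; lra.
have : C * dl <= C * `|x - v| by rewrite ler_wpM2l // ltW.
have -> : C * dl = 2 * `|M| + dl by rewrite /C; field; rewrite gt_eqF.
have := hM _ Kx; have := hM _ (sK _ vs).
rewrite !ler_norml mulNr => /andP[? ?] /andP[? ?].
by have := ler_norm M; lra.
Qed.

End PiecewiseAffine.

(** * General position of the affine pieces *)

Section Generic.
Context {R : realType}.
Implicit Types (l w : R * R * R) (s : seq (R * R * R)) (x y v p : plane R).

(** Induction on the list: step off the first line along its normal, then avoid the other lines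
    within a ball on which the first one stays avoided. *)
Lemma avoid_lines s v (e : R) : 0 < e -> (forall l, l \in s -> l.1 != 0) ->
  exists2 p, `|p - v| < e & forall l, l \in s -> affine l p != 0.
Proof.
elim: s v e => [v e e0 _|l s IH v e e0 s0].
  by exists v => //; rewrite subrr normr0.
have l0 := s0 l (mem_head _ _).
have [q qv lq] : exists2 q, `|q - v| < e / 2 & affine l q != 0.
  have [lv|lv] := eqVneq (affine l v) 0; last first.
    by exists v => //; rewrite subrr normr0 divr_gt0.
  have N0 : 0 < `|l.1| by rewrite normr_gt0.
  pose k := e / 4 / `|l.1|; have k0 : 0 < k by rewrite !divr_gt0.
  exists (v + k *: l.1).
    rewrite addrC addKr normrZ gtr0_norm // /k divfK ?gt_eqF //; lra.
  have -> : affine l (v + k *: l.1) = affine l v + k * (l.1.1 ^+ 2 + l.1.2 ^+ 2).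
    by rewrite /affine /= /GRing.scale /=; ring.
  rewrite lv add0r mulf_neq0 ?gt_eqF //.
  have : (l.1.1 != 0) || (l.1.2 != 0).
    by rewrite -negb_and; apply: contra l0 => /andP[/eqP a0 /eqP b0]; apply/eqP/plane_eq.
  move=> /orP[h|h]; first by rewrite ltr_pwDl ?sqr_ge0 // lt0r sqrf_eq0 h sqr_ge0.
  by rewrite ltr_wpDl ?sqr_ge0 // lt0r sqrf_eq0 h sqr_ge0.
have [r r0 hr] : exists2 r : R, 0 < r & forall p, `|p - q| < r -> affine l p != 0.
  have : \forall p \near q, affine l p != 0.
    apply: (@continuous_affine R l q [set r : R | r != 0]).
    by apply: open_nbhs_nbhs; split => //; exact: open_neq.
  move=> /nbhs_ballP[r /= r0 hr]; exists r => // p pq; apply: hr; exact/plane_ballP.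
have [|l' l's|p pq ps] := IH q (Num.min (e / 2) r).
- by rewrite lt_min divr_gt0.
- by apply: s0; rewrite inE l's orbT.
move: pq; rewrite lt_min => /andP[pq1 pq2].
exists p.
  by have := ler_distD q p v; lra.
by move=> l'; rewrite inE => /predU1P[->|/ps//]; exact: hr.
Qed.

Lemma near_seq {T : eqType} (r : seq T) (P : T -> plane R -> Prop) x :
  (forall i, i \in r -> \forall y \near x, P i y) ->
  \forall y \near x, forall i, i \in r -> P i y.
Proof.
elim: r => [_|i r IH h]; first exact: filterE.
have h1 := h i (mem_head _ _).
have {}IH : \forall y \near x, forall i, i \in r -> P i y.
  by apply: IH => j jr; apply: h; rewrite inE jr orbT.
by apply: filterS2 h1 IH => y Piy Pr j; rewrite inE => /predU1P[->|/Pr].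
Qed.

Local Notation det l w := (l.1.1 * w.1.2 - l.1.2 * w.1.1).

(** An affine substitute for Sard's theorem. The values to avoid are the whole image of a singular
    pair (a, b), and otherwise the image of the wall w = 0; either set lies on a single line. *)
Lemma image_line (a b w : R * R * R) : exists l, l.1 != 0 /\
  forall x, det a b = 0 \/ w.1 != 0 /\ affine w x = 0 -> affine l (affine a x, affine b x) = 0.
Proof.
have nz (m n : R) : (m != 0) || (n != 0) -> (m, n) != 0.
  by rewrite -negb_and; apply: contra => /eqP[-> ->]; rewrite !eqxx.
have [D0|D0] := eqVneq (det a b) 0.
  have [n n0 [e1 e2]] : exists2 n : plane R, n != 0 &
      n.1 * a.1.1 + n.2 * b.1.1 = 0 /\ n.1 * a.1.2 + n.2 * b.1.2 = 0.
    have [h1|h1] := boolP ((b.1.1 != 0) || (- a.1.1 != 0)).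
      by exists (b.1.1, - a.1.1); [exact: nz | move: D0 => /= D0; split; lra].
    have [h2|h2] := boolP ((b.1.2 != 0) || (- a.1.2 != 0)).
      by exists (b.1.2, - a.1.2); [exact: nz | move: D0 => /= D0; split; lra].
    exists (1, 0); first by apply: nz; rewrite oner_neq0.
    move: h1 h2; rewrite !negb_or !negbK !oppr_eq0 => /andP[_ /eqP ->] /andP[_ /eqP ->] /=.
    by split; ring.
  exists (n, - (n.1 * a.2 + n.2 * b.2)); split=> // x _; rewrite /affine /=.
  transitivity ((n.1 * a.1.1 + n.2 * b.1.1) * x.1 + (n.1 * a.1.2 + n.2 * b.1.2) * x.2).
    by ring.
  by rewrite e1 e2; ring.
(* The condition on x is now contradictory, so any line will do. *)
have [w0|w0] := eqVneq w.1 0.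
  exists ((1, 0), 0); split; first by apply: nz; rewrite oner_neq0.
  by move=> x [/eqP|[/eqP]]; rewrite ?(negbTE D0) // w0 eqxx.
(* Cramer's rule: n composed with the linear part of (a, b) is the linear part of w, so n applied to
   (a x, b x) differs from w by a constant. *)
set D := det a b in D0.
have [n [e1 e2]] : exists n : plane R, n.1 * a.1.1 + n.2 * b.1.1 = w.1.1 /\
    n.1 * a.1.2 + n.2 * b.1.2 = w.1.2.
  exists ((w.1.1 * b.1.2 - w.1.2 * b.1.1) / D, (a.1.1 * w.1.2 - a.1.2 * w.1.1) / D).
  by rewrite /D /=; split; field.
exists (n, w.2 - (n.1 * a.2 + n.2 * b.2)); split=> [|x].
  apply: contra w0 => /eqP /= n0; have [n1 n2] : n.1 = 0 /\ n.2 = 0 by rewrite n0.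
  by apply/eqP/plane_eq; [rewrite -e1 | rewrite -e2]; rewrite n1 n2 !mul0r addr0.
move=> [/eqP|[_ wx]]; first by rewrite (negbTE D0).
rewrite -wx /affine /= -e1 -e2; ring.
Qed.

(** Each component is approximated by a piecewise affine function, then a small translation v moves
    all targets off the lines of [image_line]. Where a target is attained, the active pieces are
    thus invertible and no wall passes through the point. *)
Lemma generic_approximation (H : plane R -> plane R) (K : set (plane R))
    (targets : seq (plane R)) (e : R) :
  continuous H -> compact K -> 0 < e ->
  exists H' : plane R -> plane R, [/\ continuous H',
    forall x, K x -> `|H' x - H x| < e &
    exists zeros : seq (plane R), forall x, H' x \in targets -> x \in zeros /\
      exists a b c k, a * k - b * c != 0 /\
        \forall y \near x, H' y = H' x + lin a b c k (y - x)].
Proof.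
move=> cH cK e0; have e20 : 0 < e / 2 by rewrite divr_gt0.
have [g1 [cg1 [s1 gs1]] g1H] : exists2 g, piecewise_affine g &
    forall x, K x -> `|g x - (H x).1| < e / 2 by apply: pa_dense => //; cont.
have [g2 [cg2 [s2 gs2]] g2H] : exists2 g, piecewise_affine g &
    forall x, K x -> `|g x - (H x).2| < e / 2 by apply: pa_dense => //; cont.
have /choice[L hL] : forall q : (R * R * R) * (R * R * R) * (R * R * R), exists l, l.1 != 0 /\
  forall x, det q.1.1 q.1.2 = 0 \/ q.2.1 != 0 /\ affine q.2 x = 0 ->
    affine l (affine q.1.1 x, affine q.1.2 x) = 0.
  by move=> [[a b] w]; exact: image_line.
pose walls := [seq l - l' | l <- s1 ++ s2, l' <- s1 ++ s2].
pose pairs := [seq (a, b) | a <- s1, b <- s2].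
pose lines := [seq L q | q <- [seq (ab, w) | ab <- pairs, w <- walls]].
(* That t - v is off the line l is a condition on v: the function v |-> l (t - v) is affine with
   linear part - l.1. *)
have [l|v v_small avoid] := avoid_lines [seq (- l.1, affine l t) | l <- lines, t <- targets] 0 (e / 2) e20.
  move=> /allpairsP[[l' t] [/mapP[q _ ->] _ ->]] /=; rewrite oppr_eq0.
  by have [] := hL q.
rewrite subr0 in v_small.
pose H' x : plane R := (g1 x, g2 x) + v.
have good x a b w : a \in s1 -> b \in s2 -> w \in walls -> H' x \in targets ->
    g1 x = affine a x -> g2 x = affine b x -> det a b != 0 /\ (w.1 != 0 -> affine w x != 0).
  move=> as1 bs2 ww xt gx1 gx2.
  have [_ line] := hL ((a, b), w).
  have : affine (L ((a, b), w)) (affine a x, affine b x) != 0.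
    have /avoid : (- (L ((a, b), w)).1, affine (L ((a, b), w)) (H' x)) \in
        [seq (- l.1, affine l t) | l <- lines, t <- targets].
      apply/allpairsP; exists (L ((a, b), w), H' x); split=> //.
      apply/mapP; exists ((a, b), w) => //; apply/allpairsP; exists ((a, b), w); split=> //.
      by apply/allpairsP; exists (a, b).
    apply: contra => /eqP h; apply/eqP; rewrite -h /H' gx1 gx2 /affine /=; ring.
  move=> nz; split; first by apply: contra nz => /eqP D0; apply/eqP/line; left.
  by move=> w0; apply: contra nz => /eqP wx; apply/eqP/line; right.
exists H'; split.
- by rewrite /H'; cont.
- move=> x Kx; rewrite /H' addrAC (le_lt_trans (ler_normD _ _)) //.
  rewrite [e]splitr ltrD //.
  by rewrite plane_dist_ltr /= g1H // g2H.
(* Cramer numerators for the system a x = (t - v).1, b x = (t - v).2. One candidate for each pair of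
   pieces and each target gives a finite list. *)
pose solve (a b : R * R * R) (t : plane R) : plane R :=
  (((t - v).1 - a.2) * b.1.2 - a.1.2 * ((t - v).2 - b.2),
   a.1.1 * ((t - v).2 - b.2) - ((t - v).1 - a.2) * b.1.1).
exists [seq (det ab.1 ab.2)^-1 *: solve ab.1 ab.2 t | ab <- pairs, t <- targets] => x xt.
have [a as1 gx1] := gs1 x; have [b bs2 gx2] := gs2 x.
have in_walls l l' : l \in s1 ++ s2 -> l' \in s1 ++ s2 -> l - l' \in walls.
  by move=> ls ls'; apply/allpairsP; exists (l, l').
have as12 : a \in s1 ++ s2 by rewrite mem_cat as1.
have bs12 : b \in s1 ++ s2 by rewrite mem_cat bs2 orbT.
have D0 : det a b != 0 by have [] := good x a b (a - a) as1 bs2 (in_walls _ _ as12 as12) xt gx1 gx2.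
split.
  apply/allpairsP; exists ((a, b), H' x); split=> //; first by apply/allpairsP; exists (a, b).
  have -> : solve a b (H' x) = det a b *: x.
    rewrite /solve /H' addrK gx1 gx2 /affine.
    by rewrite plane_scale; apply: plane_eq => /=; ring.
  by rewrite scalerA mulVf // scale1r.
(* Near x the selection does not switch: a piece with the value g x at x differs from c by a
   function vanishing at x, which is zero since no wall passes through x; the other pieces differ
   from g on a neighbourhood. *)
have stay (s : seq (R * R * R)) (g : plane R -> R) (c : R * R * R) : continuous g ->
    (forall y, exists2 l, l \in s & g y = affine l y) ->
    {subset s <= s1 ++ s2} -> c \in s1 ++ s2 -> g x = affine c x -> \forall y \near x, g y = affine c y.
  move=> cg gs sub cs gc.
  have : \forall y \near x, forall l, l \in s -> g y = affine l y -> affine l y = affine c y.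
    apply: near_seq => l ls.
    have [lx|lx] := eqVneq (affine l x) (g x).
      have lcw := in_walls _ _ (sub _ ls) cs.
      have [_ wall] := good x a b (l - c) as1 bs2 lcw xt gx1 gx2.
      have lc0 : affine (l - c) x = 0.
        by transitivity (affine l x - affine c x); [rewrite /affine /=; ring | rewrite lx gc subrr].
      have lc1 : (l - c).1 = 0.
        by apply/eqP; apply: contraT => /wall; rewrite lc0 eqxx.
      have [e1 e2] : (l - c).1.1 = 0 /\ (l - c).1.2 = 0 by rewrite lc1.
      have e3 : (l - c).2 = 0 by move: lc0; rewrite /affine e1 e2 !mul0r !add0r.
      apply: filterE => y _; apply/eqP; rewrite -subr_eq0; apply/eqP.
      transitivity (affine (l - c) y); first by rewrite /affine /=; ring.
      by rewrite /affine e1 e2 e3 !mul0r !add0r.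
    have ch : continuous (fun y => affine l y - g y) by rewrite /affine; cont.
    have : \forall y \near x, affine l y - g y != 0.
      apply: (ch x [set r : R | r != 0]); apply: open_nbhs_nbhs; split; first exact: open_neq.
      by rewrite /= subr_eq0.
    by apply: filterS => y + gy; rewrite gy subrr eqxx.
  by apply: filterS => y hy; have [l ls gl] := gs y; rewrite gl; exact: hy.
exists a.1.1, a.1.2, b.1.1, b.1.2; split=> //.
have n1 := stay s1 g1 a cg1 gs1 _ as12 gx1.
have n2 := stay s2 g2 b cg2 gs2 _ bs12 gx2.
apply: filterS2 (n1 _) (n2 _) => [y h1 h2|l ls|l ls]; last 2 first.
- by rewrite mem_cat ls.
- by rewrite mem_cat ls orbT.
by rewrite /H' /lin h1 h2 gx1 gx2 /affine; apply: plane_eq => /=; ring.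
Qed.

End Generic.

(** * Polar-like coordinates *)

Section Polar.
Context {R : realType} {Psi : plane R -> plane R}.
Hypothesis hPsi : polar_coordinates Psi.
Implicit Types (x y z : plane R) (a r : R) (k : int).

Lemma periodic_int {X : Type} {F : plane R -> X} a r k : angle_periodic (chalfplane R) F ->
  0 <= r -> F (a + 2 * pi * k%:~R, r) = F (a, r).
Proof.
move=> pF r0.
have nat_case (n : nat) b : F (b + 2 * pi * n%:R, r) = F (b, r).
  elim: n b => [|n IH] b; first by rewrite mulr0 addr0.
  rewrite -(IH b) -(pF (b + 2 * pi * n%:R)) //; congr (F (_, _)).
  by rewrite -[in LHS]natr1; ring.
case: k => n; first exact: nat_case.
rewrite -(nat_case n.+1 (a + _)) NegzE; congr (F (_, _)).
by rewrite mulrNz; ring.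
Qed.

Lemma polar_int a r k : 0 <= r -> Psi (a + 2 * pi * k%:~R, r) = Psi (a, r).
Proof. exact: (periodic_int _ _ _ (polar_periodic hPsi)). Qed.

Lemma angle_reduce a : exists k : int, 0 <= a + 2 * pi * k%:~R < 2 * pi.
Proof.
have p0 : 0 < 2 * pi :> R by rewrite mulr_gt0 // pi_gt0.
move: (2 * pi) p0 => p p0; exists (- Num.floor (a / p)).
have /andP[h1 h2] := floor_itv (a / p).
have -> : a + p * (- Num.floor (a / p))%:~R = p * (a / p - (Num.floor (a / p))%:~R).
  by rewrite mulrNz; field; exact: lt0r_neq0.
rewrite mulr_ge0 ?subr_ge0 // ?ltW //= gtr_pMr // ltrBlDr addrC.
by rewrite intrD in h2.
Qed.

Lemma polar_inj a r a' r' : 0 < r -> 0 < r' -> Psi (a, r) = Psi (a', r') ->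
  r' = r /\ exists k : int, a' = a + 2 * pi * k%:~R.
Proof.
move=> r0 r0'; have [k hk] := angle_reduce a; have [k' hk'] := angle_reduce a'.
rewrite -(polar_int a r k (ltW r0)) -(polar_int a' r' k' (ltW r0')).
have [_ inj _] := polar_bij hPsi.
have dom (b s : R) : 0 <= b < 2 * pi -> 0 < s ->
    (b, s) \in `[0, 2 * pi[%classic `*` `]0, +oo[%classic.
  by move=> hb s0; rewrite inE; split; rewrite /= in_itv /= ?andbT.
move=> /(inj _ _ (dom _ _ hk r0) (dom _ _ hk' r0')) [e ->]; split=> //.
by exists (k - k'); rewrite intrB mulrBr addrA e addrK.
Qed.

Lemma polar_surj x : x <> 0 -> exists2 y, 0 < y.2 & Psi y = x.
Proof.
have [_ _ surj] := polar_bij hPsi.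
move=> /surj [y [_ /=]]; rewrite in_itv /= andbT => y0 yx.
by exists y.
Qed.

(** This is the point that [descend] selects, so [descend Psi F x] and [F (polar_pt x)] are
    convertible. *)
Definition polar_pt x : plane R := xget 0 (polar_preim Psi [set x]).

Lemma polar_ptP x : 0 <= (polar_pt x).2 /\ Psi (polar_pt x) = x.
Proof.
rewrite /polar_pt; case: xgetP => [y _ [y0 yx] //|none].
exfalso; have [x0|/eqP x0] := eqVneq x 0.
  apply: (none (0, 0)); split; first exact: lexx.
  by rewrite x0 /=; apply/(polar_eq0 hPsi); [exact: lexx|].
have [y y0 yx] := polar_surj _ x0.
by apply: (none y); split => //; exact: ltW.
Qed.

Lemma polar_pt_gt0 x : x <> 0 -> 0 < (polar_pt x).2.
Proof.
have [h0 hx] := polar_ptP x; move=> x0; rewrite lt0r h0 andbT; apply/eqP => e.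
by apply: x0; rewrite -hx; apply/(polar_eq0 hPsi).
Qed.

Lemma polar_pt0 : (polar_pt 0).2 = 0.
Proof. by have [h0 hx] := polar_ptP 0; apply/(polar_eq0 hPsi). Qed.

Lemma polar_pt_shift y : 0 < y.2 ->
  exists k : int, polar_pt (Psi y) = (y.1 + 2 * pi * k%:~R, y.2).
Proof.
move=> y0; have [h0 hx] := polar_ptP (Psi y).
have p0 : 0 < (polar_pt (Psi y)).2.
  apply: polar_pt_gt0 => /(polar_eq0 hPsi (y := y) (ltW y0)) h.
  by rewrite h ltxx in y0.
move: hx h0 p0; case: (polar_pt _) => a r; case: y y0 => b s /= s0 E _ r0.
by have [-> [k ->]] := polar_inj _ _ _ _ s0 r0 (esym E); exists k.
Qed.

(* The angle of [polar_pt] is a discontinuous choice, hence the use of local branches. *)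
Lemma polar_branch x : x <> 0 -> exists q : plane R -> plane R,
  [/\ continuous_at x q & \forall z \near x, 0 < (q z).2 /\ Psi (q z) = z].
Proof.
move=> /polar_surj [y y0 <-].
have [V [oV Vy VA oPV [cP [q [cq qP]]]]] := polar_local_homeo hPsi (y := y) y0.
have nV : nbhs (Psi y) (Psi @` V) by apply: open_nbhs_nbhs; split=> //; exists y.
exists q; split.
  have /within_cont_in/(_ (Psi y)) := cq.
  rewrite /cont_in within_interior; last exact: nV.
  by apply; exists y.
apply: filterS nV => _ [z Vz <-]; rewrite qP //; split=> //; exact: VA.
Qed.

Lemma continuous_polar_abs : continuous (fun y => Psi (y.1, `|y.2|)).
Proof.
apply/continuous_cont_in => y.
apply: (cont_in_comp_within (B := chalfplane R) (g := Psi)) => [z _||].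
- exact: normr_ge0.
- by have /within_cont_in := polar_continuous hPsi; apply; exact: normr_ge0.
- by cont.
Qed.

(** By periodicity the angle may be confined to the compact segment [0, 2 pi], over which continuity
    at r = 0 is uniform. *)
Lemma uniform_at_boundary (F : plane R -> plane R) (c : plane R) (e : R) :
  {within chalfplane R, continuous F} -> angle_periodic (chalfplane R) F ->
  (forall a, F (a, 0) = c) -> 0 < e ->
  exists2 dl, 0 < dl & forall y, 0 <= y.2 < dl -> `|F y - c| < e.
Proof.
move=> cF pF F0 e0; have p0 : 0 < 2 * pi :> R by rewrite mulr_gt0 // pi_gt0.
have /compact_near_coveringP cK := @segment_compact R 0 (2 * pi).
have [|dl /= dl0 hdl] := cK _ (nbhs (0 : R)) (fun r a => 0 <= r -> `|F (a, r) - c| < e) _.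
  move=> a _.
  have /within_cont_in/(_ (a, 0) (lexx _)) : {within chalfplane R, continuous F} by [].
  move=> /cvgrPdist_lt/(_ e e0); rewrite F0 => -[[A B] /= [nA nB] AB].
  exists (A, B) => // -[b r] /= [Ab Br] r0.
  by rewrite distrC; apply: (AB (b, r)).
exists dl => // -[a r] /= /andP[r0 rdl]; have [k /andP[k0 k1]] := angle_reduce a.
rewrite -(periodic_int a r k pF r0); apply: (hdl r) => //=.
  by rewrite sub0r normrN ger0_norm.
by rewrite in_itv /= k0 ltW.
Qed.

(** Unlike the angle, the radius is the same for every choice of preimage, so it agrees with that of
    a continuous local branch. *)
Lemma continuous_polar_radius_neq0 x : x <> 0 -> continuous_at x (fun z => (polar_pt z).2).
Proof.
move=> /polar_branch [q [cq nq]].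
have cq2 : continuous_at x (fun z => (q z).2) by cont.
have E : \forall z \near x, (q z).2 = (polar_pt z).2.
  by apply: filterS nq => z [q0 qz]; have [k] := polar_pt_shift _ q0; rewrite qz => ->.
rewrite /continuous_at -(nbhs_singleton E).
exact: cvg_trans (near_eq_cvg E) cq2.
Qed.

Lemma polar_radius_segment x z r :
  (forall t, 0 <= t <= 1 -> (1 - t) *: x + t *: z <> 0 /\
     (polar_pt ((1 - t) *: x + t *: z)).2 <> r) ->
  (polar_pt z).2 < r -> (polar_pt x).2 < r.
Proof.
move=> seg zr; rewrite ltNge; apply/negP => xr.
pose f t := (polar_pt ((1 - t) *: x + t *: z)).2.
have [||t] := @IVT R f 0 1 r ler01.
- apply/within_cont_in => t; rewrite /= in_itv /= => t01.
  have cf := continuous_polar_radius_neq0 _ (proj1 (seg t t01)).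
  by refine (cont_in_comp (f := fun t : R => (1 - t) *: x + t *: z) (g := fun z => (polar_pt z).2) cf _); cont.
- rewrite /f subr0 scale1r scale0r addr0 subrr scale0r scale1r add0r.
  by rewrite ge_min le_max (ltW zr) xr orbT.
- rewrite in_itv /= => t01; exact: (proj2 (seg t t01)).
Qed.

(** This is the continuity at 0 of the inverse of [Psi]. The closed curve r = e has a positive
    distance m from 0, so the radius cannot cross e along a segment inside the ball of radius m that
    avoids 0. Some point z of this ball has radius below e, and one or two bends join any x to
    it. *)
Lemma polar_radius_at0 (e : R) : 0 < e ->
  exists2 dl, 0 < dl & forall x, `|x| < dl -> (polar_pt x).2 < e.
Proof.
move=> e0; have p0 : 0 < 2 * pi :> R by rewrite mulr_gt0 // pi_gt0.
have cP := continuous_polar_abs.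
have [a0 _ min_a0] : exists2 a0, a0 \in `[0, 2 * pi] &
    forall a, a \in `[0, 2 * pi] -> `|Psi (a0, `|e|)| <= `|Psi (a, `|e|)|.
  apply: (@EVT_min R (fun a => `|Psi (a, `|e|)|)); first exact: ltW.
  apply: continuous_subspaceT; apply/continuous_cont_in => a; apply: cont_in_norm.
  by apply: (cont_in_comp (f := fun a : R => (a, e)) (cP _)); cont.
rewrite gtr0_norm // in min_a0; pose m := `|Psi (a0, e)|.
have m0 : 0 < m.
  rewrite normr_gt0; apply/eqP => /(polar_eq0 hPsi (y := (a0, e)) (ltW e0)) /= h.
  by rewrite h ltxx in e0.
have neq x : `|x| < m -> (polar_pt x).2 <> e.
  have [_ hx] := polar_ptP x; move: hx; case: (polar_pt x) => a r /= hx xm re.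
  have [k hk] := angle_reduce a.
  have := min_a0 (a + 2 * pi * k%:~R); rewrite re in hx; rewrite polar_int ?(ltW e0) // hx -/m.
  by rewrite in_itv /= => /(_ _) h; move: xm; rewrite ltNge h //; case/andP: hk => -> /ltW ->.
have [dl dl0 hdl] := uniform_at_boundary Psi 0 m (polar_continuous hPsi) (polar_periodic hPsi)
  (fun a => proj2 (polar_eq0 hPsi (y := (a, 0)) (lexx _)) erefl) m0.
pose e' := Num.min dl e / 2.
have e'0 : 0 < e' by rewrite divr_gt0 // lt_min dl0.
have [e'd e'e] : e' < dl /\ e' < e.
  have : Num.min dl e <= dl by rewrite ge_min lexx.
  have : Num.min dl e <= e by rewrite ge_min lexx orbT.
  by rewrite /e'; split; lra.
pose z := Psi (0, e').
have zm : `|z| < m by have := hdl (0, e'); rewrite subr0; apply; rewrite /= ltW.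
have zr : (polar_pt z).2 < e by have [k ->] := polar_pt_shift (0, e') e'0.
have z0 : z <> 0.
  move=> /(polar_eq0 hPsi (y := (0, e')) (ltW e'0)) /= h.
  by rewrite h ltxx in e'0.
have seg x w : `|x| < m -> `|w| < m -> (forall t, 0 <= t <= 1 -> (1 - t) *: x + t *: w <> 0) ->
    (polar_pt w).2 < e -> (polar_pt x).2 < e.
  move=> xm wm n0; apply: polar_radius_segment => t t01; split; first exact: n0.
  apply: neq; apply: le_lt_trans (ler_normD _ _) _; rewrite !normrZ.
  case/andP: (t01) => t0 t1; rewrite ger0_norm ?subr_ge0 // ger0_norm //.
  have := @convex_gt0 R t (m - `|x|) (m - `|w|) t01; rewrite !subr_gt0 => /(_ xm wm).
  lra.
exists m => // x xm; have [x0|x0] := pselect (x = 0); first by rewrite x0 polar_pt0.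
have [[t [t01 xz]]|nt] := pselect (exists t, 0 <= t <= 1 /\ (1 - t) *: x + t *: z = 0); last first.
  by apply: (seg x z) => // t t01 xz; apply: nt; exists t.
(* [z] is a negative multiple of [x]: go around the origin through a rotation of [x]. *)
pose w : plane R := (- x.2, x.1).
have wm : `|w| < m by move: xm; rewrite !plane_norm_ltr /= normrN andbC.
have xx : x.1 * x.1 + x.2 * x.2 <> 0.
  move=> h; apply: x0; apply: plane_eq; apply/eqP; rewrite -sqrf_eq0 expr2; apply/eqP => /=; nra.
have {xz} [xz1 xz2] : (1 - t) * x.1 + t * z.1 = 0 /\ (1 - t) * x.2 + t * z.2 = 0.
  by move: xz; rewrite !plane_scale => -[].
apply: (seg x w) => //.
  move=> s _; rewrite !plane_scale /= => -[h1 h2].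
  have e1 : (1 - s) * (x.1 * x.1 + x.2 * x.2) = 0.
    transitivity (x.1 * ((1 - s) * x.1 + s * - x.2) + x.2 * ((1 - s) * x.2 + s * x.1)); first by ring.
    by rewrite h1 h2; ring.
  have e2 : s * (x.1 * x.1 + x.2 * x.2) = 0.
    transitivity (x.1 * ((1 - s) * x.2 + s * x.1) - x.2 * ((1 - s) * x.1 + s * - x.2)); first by ring.
    by rewrite h1 h2; ring.
  by apply: xx; rewrite -[LHS]mul1r -(subrK s 1) mulrDl e1 e2 addr0.
apply: (seg w z) => // s _; rewrite !plane_scale /= => -[h1 h2].
(* Here z lies on the line through 0 and x, and w is orthogonal to x, so the segment from w to z
   meets this line only at z. The factor t clears the denominator of z as a multiple of x. *)
have e1 : (t * (1 - s)) * (x.1 * x.1 + x.2 * x.2) = 0.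
  transitivity (- x.2 * (t * ((1 - s) * - x.2 + s * z.1)) + x.1 * (t * ((1 - s) * x.1 + s * z.2))
    + s * (x.2 * ((1 - t) * x.1 + t * z.1) - x.1 * ((1 - t) * x.2 + t * z.2))); first by ring.
  by rewrite h1 h2 xz1 xz2; ring.
move: e1 => /eqP; rewrite mulf_eq0 => /orP[|/eqP //].
rewrite mulf_eq0 => /orP[/eqP tz|/eqP s1].
  by apply: x0; apply: plane_eq => /=; move: xz1 xz2; rewrite tz !mul0r subr0 !mul1r !addr0.
have s1' : s = 1 by lra.
by apply: z0; apply: plane_eq => /=; move: h1 h2; rewrite s1' subrr !mul0r !add0r !mul1r.
Qed.

(* The absolute value keeps the argument of [Psi] in the closed half-plane. *)
Definition turn x a (b : R) : plane R := Psi ((polar_pt x).1 + a, `|b| * (polar_pt x).2).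

Lemma turn_branch y a (b : R) : 0 < y.2 -> turn (Psi y) a b = Psi (y.1 + a, `|b| * y.2).
Proof.
move=> y0; have [k] := polar_pt_shift _ y0; rewrite /turn => -> /=.
by rewrite addrAC polar_int // mulr_ge0 // ltW.
Qed.

Lemma turn01 x : turn x 0 1 = x.
Proof.
rewrite /turn addr0 normr1 mul1r; have [_ ] := polar_ptP x.
by case: (polar_pt x).
Qed.

Lemma turn_at0 a (b : R) : turn 0 a b = 0.
Proof.
rewrite /turn polar_pt0 mulr0; apply: (proj2 (polar_eq0 hPsi _)) => //; exact: lexx.
Qed.

Lemma turn_eq0 x a (b : R) : turn x a b = 0 -> x <> 0 -> b = 0.
Proof.
move=> + x0; have p0 := polar_pt_gt0 _ x0.
have h0 : chalfplane R ((polar_pt x).1 + a, `|b| * (polar_pt x).2).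
  by rewrite /chalfplane /= mulr_ge0 // ltW.
move=> /(polar_eq0 hPsi h0) /= /eqP; rewrite mulf_eq0 normr_eq0 => /orP[/eqP //|/eqP p].
by rewrite p ltxx in p0.
Qed.

Lemma turn_inj x a (b : R) a' b' : x <> 0 -> 0 < b -> 0 < b' -> turn x a b = turn x a' b' ->
  b' = b /\ exists k : int, a' = a + 2 * pi * k%:~R.
Proof.
move=> /polar_pt_gt0 p0 b0 b0'; rewrite /turn !gtr0_norm // => E.
have [e [k ek]] := polar_inj _ _ _ _ (mulr_gt0 b0 p0) (mulr_gt0 b0' p0) E.
split; first by apply: (mulIf (lt0r_neq0 p0)).
by exists k; apply: (addrI (polar_pt x).1); rewrite ek addrA.
Qed.

Lemma turn_int x a (b : R) k : turn x (a + 2 * pi * k%:~R) b = turn x a b.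
Proof.
rewrite /turn addrA polar_int // mulr_ge0 //; have [h _] := polar_ptP x; exact: h.
Qed.

(** Away from the origin a continuous branch replaces [polar_pt]. At the origin the angle is out of
    control, but the radius tends to 0, and [Psi] tends to 0 with it uniformly in the angle. *)
Lemma continuous_turn : continuous (fun p : plane R * R * R => turn p.1.1 p.1.2 p.2).
Proof.
move=> [[x a] b]; have [->|x0] := pselect (x = 0); last first.
  have [q [cq nq]] := polar_branch _ x0.
  have cP := continuous_polar_abs.
  pose f (p : plane R * R * R) :=
    (fun y => Psi (y.1, `|y.2|)) ((q p.1.1).1 + p.1.2, `|p.2| * (q p.1.1).2).
  have cf : continuous_at (x, a, b) f.
    apply/cont_inT; apply: (cont_in_comp (f := fun p : plane R * R * R =>
      ((q p.1.1).1 + p.1.2, `|p.2| * (q p.1.1).2)) (cP _)).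
    have cq' : cont_in setT (x, a, b) (fun p : plane R * R * R => q p.1.1).
      by apply: cont_in_comp => //; cont.
    by cont.
  have E : \forall p \near (x, a, b), f p = turn p.1.1 p.1.2 p.2.
    have c1 : continuous_at (x, a, b) (fun p : plane R * R * R => p.1.1) by cont.
    have n1 : \forall p \near (x, a, b), 0 < (q p.1.1).2 /\ Psi (q p.1.1) = p.1.1.
      exact: (c1 _ nq).
    apply: filterS n1 => -[[z a'] b'] /= [q0 qz].
    by rewrite -{2}qz turn_branch // /f /= ger0_norm // mulr_ge0 // ltW.
  rewrite /continuous_at -(nbhs_singleton E).
  exact: cvg_trans (near_eq_cvg E) cf.
apply/cvgrPdist_lt => e e0; rewrite /= turn_at0.
have [dl dl0 hdl] := uniform_at_boundary Psi 0 e (polar_continuous hPsi) (polar_periodic hPsi)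
  (fun a => proj2 (polar_eq0 hPsi (y := (a, 0)) (lexx _)) erefl) e0.
have b0 : 0 < `|b| + 1 by rewrite ltr_wpDl.
have [d0 d00 hd0] := polar_radius_at0 (dl / (`|b| + 1)) (divr_gt0 dl0 b0).
have c1 : continuous_at (0 : plane R, a, b) (fun p : plane R * R * R => `|p.1.1|) by cont.
have c2 : continuous_at (0 : plane R, a, b) (fun p : plane R * R * R => `|p.2|) by cont.
have n1 : \forall p \near (0 : plane R, a, b), `|p.1.1| < d0.
  by apply: (c1 [set r : R | r < d0]); apply: open_nbhs_nbhs; split; [exact: open_lt | rewrite /= normr0].
have n2 : \forall p \near (0 : plane R, a, b), `|p.2| < `|b| + 1.
  by apply: (c2 [set r : R | r < `|b| + 1]); apply: open_nbhs_nbhs; split; [exact: open_lt | rewrite /= ltrDl].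
apply: filterS2 n1 n2 => -[[z a'] b'] /= /hd0 zr bb.
have [r0 _] := polar_ptP z.
have := hdl ((polar_pt z).1 + a', `|b'| * (polar_pt z).2).
rewrite subr0 sub0r normrN; apply; rewrite /= mulr_ge0 //=.
rewrite ltr_pdivlMr // in zr; apply: le_lt_trans zr.
by rewrite mulrC ler_wpM2l // ltW.
Qed.

Lemma continuous_descend (F : plane R -> plane R) c :
  {within chalfplane R, continuous F} -> angle_periodic (chalfplane R) F ->
  (forall a, F (a, 0) = c) -> continuous (descend Psi F).
Proof.
move=> cF pF F0 x.
have dE z : descend Psi F z = F (polar_pt z) by [].
have [->|x0] := pselect (x = 0).
  apply/cvgrPdist_lt => e e0; rewrite dE.
  have -> : F (polar_pt 0) = c by have := polar_pt0; case: (polar_pt 0) => a r /= ->.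
  have [dl dl0 hdl] := uniform_at_boundary F c e cF pF F0 e0.
  have [d0 d00 hd0] := polar_radius_at0 _ dl0.
  apply: (filterS _ (nbhsx_ballx (0 : plane R) d0 d00)) => z /plane_ballP; rewrite subr0 => /hd0 zr.
  by rewrite /= dE distrC; apply: hdl; have [-> _] := polar_ptP z.
have [q [cq nq]] := polar_branch _ x0.
have cf : continuous_at x (fun z => F ((q z).1, `|(q z).2|)).
  apply/cont_inT; apply: (cont_in_comp_within (B := chalfplane R) (g := F)
    (f := fun z => ((q z).1, `|(q z).2|))) => [z _||].
  - exact: normr_ge0.
  - by have /within_cont_in := cF; apply; exact: normr_ge0.
  - by cont.
have E : \forall z \near x, F ((q z).1, `|(q z).2|) = descend Psi F z.
  apply: filterS nq => z [q0 qz]; rewrite dE; have [k] := polar_pt_shift _ q0.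
  by rewrite qz => ->; rewrite periodic_int ?ltW // gtr0_norm.
rewrite /continuous_at -(nbhs_singleton E).
exact: cvg_trans (near_eq_cvg E) cf.
Qed.

End Polar.

(** * The degree of a displacement *)

(** The sign rule gives the same value for every germ of index 1, and the identity is one of
    them. *)
Lemma ind_lin_of_ind1 {R : realType} {d : (plane R -> plane R) -> set (plane R) -> plane R -> int}
    (hd : brouwer_degree d) {Q : plane R -> plane R} (a b c k : R) :
  continuous Q -> (forall w, Q w = 0 -> w = 0) -> d Q (ball 0 1) 0 = 1 ->
  a * k - b * c != 0 ->
  d (Q \o lin a b c k) (ball 0 1) 0 = d (lin a b c k) (ball 0 1) 0.
Proof.
move=> cQ Q0 Q1 D0.
have id1 : d id (ball (0 : plane R) 1) 0 = 1.
  by apply: (brouwer_normalization hd); [exact: ball_open | exact: bounded_ball | exact: ballxx].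
have cid : continuous (@id (plane R)) by cont.
have E (P : plane R -> plane R) : continuous P -> (forall w, P w = 0 -> w = 0) ->
    d P (ball 0 1) 0 = 1 ->
    d (P \o lin a b c k) (ball 0 1) 0 = if 0 < a * k - b * c then 1 else -1.
  move=> cP P0 P1; rewrite (ind_lin_sg hd cP P0) //.
  case: (ltgtP (a * k - b * c) 0) D0 => // Dk _.
    by rewrite ?(ltr0_sg Dk) (ind_reflection hd cP P0) P1.
  rewrite ?(gtr0_sg Dk) -[RHS]P1; congr (d _ _ _).
  by apply/funext => w /=; congr P; apply: plane_eq; rewrite /lin /=; ring.
by rewrite (E Q) // -(E id).
Qed.

(** The numbers r (e^c - 1) and c have the same sign, so their convex combinations cancel only for c
    = 0. This allows radii to be exchanged for their logarithms, both in the germ of [Psi] and in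
    the definition of [Deg]. *)
Lemma mix_expR {R : realType} (t r c : R) : 0 <= t <= 1 -> 0 < r ->
  (1 - t) * (r * (expR c - 1)) + t * c = 0 -> c = 0.
Proof.
move=> t01 r0 h; case: (ltgtP c 0) => // c0; exfalso; move: h.
  have e0 : 0 < - (r * (expR c - 1)).
    by rewrite -mulrN opprB mulr_gt0 // subr_gt0 -(expR0 R) ltr_expR.
  have c0' : 0 < - c by rewrite oppr_gt0.
  by have := convex_gt0 t01 e0 c0'; lra.
have e0 : 0 < r * (expR c - 1).
  by rewrite mulr_gt0 // subr_gt0 -(expR0 R) ltr_expR.
by have := convex_gt0 t01 e0 c0; lra.
Qed.

Lemma small_angle {R : realType} (k : int) : `|2 * pi * k%:~R : R| < 2 * pi -> k = 0.
Proof.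
have p0 : 0 < 2 * pi :> R by rewrite mulr_gt0 // pi_gt0.
rewrite normrM (gtr0_norm p0) gtr_pMr // -intr_norm -[1]/(1%:~R) ltr_int => h.
by apply/eqP; rewrite -absz_eq0; move: h; rewrite -abszE ltz_nat ltnS leqn0.
Qed.

Section Core.
Context {R : realType} {Psi : plane R -> plane R}.
Hypothesis hPsi : polar_coordinates Psi.
Implicit Types (H : plane R -> plane R) (U : set (plane R)) (x y z w : plane R).
Let hd := brouwer_degree_deg hPsi.
Local Notation turn := (turn (Psi := Psi)).

(* [H] prescribes the increments of the angle and of the logarithm of the radius. *)
Definition displacement H x : plane R := turn x (H x).1 (expR (H x).2) - x.

Lemma continuous_displacement_param (H : R -> plane R -> plane R) :
  continuous (fun p : R * plane R => H p.1 p.2) ->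
  continuous (fun p : R * plane R => displacement (H p.1) p.2).
Proof.
move=> cH; rewrite /displacement; have cT := continuous_turn hPsi.
have cT' : continuous (fun p : R * plane R => turn p.2 (H p.1 p.2).1 (expR (H p.1 p.2).2)).
  apply/continuous_cont_in => p.
  by apply: (cont_in_comp (f := fun p : R * plane R => (p.2, (H p.1 p.2).1, expR (H p.1 p.2).2)) (cT _)); cont.
by cont.
Qed.

Lemma continuous_displacement H : continuous H -> continuous (displacement H).
Proof.
move=> cH; have cD : continuous (fun p : R * plane R => displacement H p.2).
  by apply: (continuous_displacement_param (fun=> H)); cont.
apply/continuous_cont_in => x.
by apply: (cont_in_comp (f := fun x : plane R => (0 : R, x)) (cD _)); cont.
Qed.

Lemma displacement_eq0 H x : x <> 0 ->
  displacement H x = 0 <-> exists i, H x = nu R i.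
Proof.
move=> x0; split.
  move=> /subr0_eq; rewrite -[in RHS](turn01 hPsi x) => /esym E.
  have [e [k ek]] := turn_inj hPsi _ _ _ _ _ x0 ltr01 (expR_gt0 _) E.
  exists k; apply: plane_eq => /=; first by rewrite ek add0r.
  by apply: expR_inj; rewrite e expR0.
move=> [i Hx]; rewrite /displacement Hx /= expR0.
by rewrite -[2 * pi * _]add0r turn_int // turn01 // subrr.
Qed.

(** Truncation makes w = 0 the only zero of [turn_at z] in the whole plane, because 1 < 2 pi, as the
    index lemmas require; the germ at 0 is unchanged. *)
Definition clamp (r : R) : R := Num.max (-1) (Num.min r 1).

Lemma clamp_id (r : R) : `|r| <= 1 -> clamp r = r.
Proof.
rewrite ler_norml => /andP[h1 h2]; rewrite /clamp.
by rewrite (min_idPl h2) (max_idPr h1).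
Qed.

Lemma clamp_le1 (r : R) : `|clamp r| <= 1.
Proof.
rewrite ler_norml /clamp le_max lexx /= ge_max ge_min lexx orbT andbT.
by lra.
Qed.

Lemma clamp_eq0 (r : R) : clamp r = 0 -> r = 0.
Proof.
rewrite /clamp; case: (lerP r 1) => h1; last by case: lerP => h2 h; lra.
by case: (lerP (-1) r) => h2 h; lra.
Qed.

Definition turn_at z w : plane R := turn z (clamp w.1) (expR (clamp w.2)) - z.

Lemma continuous_turn_at z : continuous (turn_at z).
Proof.
have cT := continuous_turn hPsi.
have cT' : continuous (fun w : plane R => turn z (clamp w.1) (expR (clamp w.2))).
  apply/continuous_cont_in => w.
  by apply: (cont_in_comp (f := fun w : plane R => (z, clamp w.1, expR (clamp w.2))) (cT _));
    rewrite /clamp; cont.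
by rewrite /turn_at; cont.
Qed.

Lemma two_pi_gt1 : 1 < 2 * pi :> R.
Proof. by have := pi_ge2 R; lra. Qed.

Lemma turn_at_eq0 z w : z <> 0 -> turn_at z w = 0 -> w = 0.
Proof.
move=> z0 /subr0_eq; rewrite -[in RHS](turn01 hPsi z) => /esym E.
have [e [k ek]] := turn_inj hPsi _ _ _ _ _ z0 ltr01 (expR_gt0 _) E.
rewrite add0r in ek.
have k0 : k = 0.
  by apply: (@small_angle R); rewrite -ek (le_lt_trans (clamp_le1 _)) // two_pi_gt1.
rewrite k0 mulr0 in ek.
apply: plane_eq; first exact: clamp_eq0.
by apply/clamp_eq0/expR_inj; rewrite e expR0.
Qed.

(** If [Psi y0 = z], then near y0 the germ at w = y - y0 is Psi (y.1, y0.2 e^(y.2 - y0.2)) - z.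
    Deforming the radius to y.2 gives Psi - z, whose degree is prescribed by the orientation
    axiom. *)
Lemma ind_turn_at z : z <> 0 -> deg (turn_at z) (ball 0 1) 0 = 1.
Proof.
move=> z0; have [y0 y00 yz] := polar_surj hPsi _ z0.
(* Small enough for the closed ball to lie in the open half-plane, and for two of its angles to
   differ by at most 1 < 2 pi, which makes [Psi] injective on it. *)
pose e := Num.min 1 y0.2 / 2.
have e0 : 0 < e by rewrite divr_gt0 // lt_min ltr01.
have [e1 ey] : e <= 1 / 2 /\ e < y0.2.
  have : Num.min 1 y0.2 <= 1 by rewrite ge_min lexx.
  have : Num.min 1 y0.2 <= y0.2 by rewrite ge_min lexx orbT.
  by rewrite /e; split; lra.
have oB : open (ball y0 e) by exact: ball_open.
have bB : bounded_set (ball y0 e) by exact: bounded_ball.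
rewrite -(deg_single_zero hd (z := y0) (W := ball y0 e)) //; first last.
- exact: ballxx.
- by move=> w; exact: turn_at_eq0.
- exact: continuous_turn_at.
have yz' : Psi (y0.1, y0.2) = z by rewrite -surjective_pairing.
have near_y0 y : closure (ball y0 e) y -> `|y.1 - y0.1| <= e /\ `|y.2 - y0.2| <= e.
  by move=> /closure_ball_norm; rewrite plane_dist_ler => /andP[].
have pos y : closure (ball y0 e) y -> 0 < y.2.
  by move=> /near_y0 [_]; rewrite ler_norml => /andP[h _]; lra.
have ang y k : closure (ball y0 e) y -> y.1 = y0.1 + 2 * pi * k%:~R -> y.1 = y0.1.
  move=> /near_y0 [h _] yk; suff k0 : k = 0 by rewrite yk k0 mulr0 addr0.
  apply: (@small_angle R); rewrite yk addrC addKr in h.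
  by apply: le_lt_trans h _; have := two_pi_gt1; lra.
pose h t (y : plane R) :=
  Psi (y.1, `|(1 - t) * (y0.2 * expR (y.2 - y0.2)) + t * y.2|) - z.
have hpos t y : 0 <= t <= 1 -> closure (ball y0 e) y ->
    0 < (1 - t) * (y0.2 * expR (y.2 - y0.2)) + t * y.2.
  by move=> t01 cy; apply: convex_gt0 (pos _ cy); rewrite // mulr_gt0 // expR_gt0.
have ch : continuous (fun p : R * plane R => h p.1 p.2).
  have cP := continuous_polar_abs hPsi.
  have cP' : continuous (fun p : R * plane R =>
      Psi (p.2.1, `|(1 - p.1) * (y0.2 * expR (p.2.2 - y0.2)) + p.1 * p.2.2|)).
    apply/continuous_cont_in => p; apply: (cont_in_comp (f := fun p : R * plane R =>
      (p.2.1, (1 - p.1) * (y0.2 * expR (p.2.2 - y0.2)) + p.1 * p.2.2)) (cP _)).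
    by cont.
  by rewrite /h; cont.
have cht t : continuous (h t).
  apply/continuous_cont_in => y.
  by apply: (cont_in_comp (f := fun y : plane R => (t, y)) (ch _)); cont.
have h_neq0 t y : 0 <= t <= 1 -> bd (ball y0 e) y -> h t y <> 0.
  move=> t01 /(bdP _ _ oB) [cy nB] /subr0_eq.
  rewrite (gtr0_norm (hpos _ _ t01 cy)) -yz' => /esym E.
  have [e2 [k ek]] := polar_inj hPsi _ _ _ _ y00 (hpos _ _ t01 cy) E.
  have y2 : y.2 - y0.2 = 0.
    by apply: (mix_expR t y0.2 (y.2 - y0.2) t01 y00); move: e2; lra.
  apply: nB; apply/plane_ballP.
  by rewrite plane_dist_ltr (ang _ _ cy ek) y2 subrr normr0 e0.
rewrite (deg_eq_closure hd _ (h 0)) //; first last.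
- move=> y /(bdP _ _ oB) [_ nB] /(turn_at_eq0 _ _ z0) /subr0_eq yy.
  by apply: nB; rewrite yy; exact: ballxx.
- move=> y /near_y0 [d1 d2]; rewrite /turn_at /h; congr (_ - z).
  rewrite !clamp_id; [|by rewrite (le_trans d2) //; lra|by rewrite (le_trans d1) //; lra].
  rewrite -yz turn_branch // subr0 mul1r mul0r addr0 /=; congr (Psi (_, _)).
    by rewrite addrC subrK.
  by rewrite normrM (gtr0_norm y00) mulrC.
- by apply: continuous_subspaceT; have cA := continuous_turn_at z; cont.
rewrite (deg_homotopy hd) //; last exact: continuous_subspaceT.
have cPsi : {within closure (ball y0 e), continuous Psi}.
  apply: continuous_subspaceW (polar_continuous hPsi) => y cy; exact/ltW/pos.
have orient : deg Psi (ball y0 e) (Psi y0) = 1.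
  apply: (polar_orientation hPsi) => //.
  - exact: ballxx.
  move=> [a r] [a' r'] /set_mem cy /set_mem cy'.
  move=> /(polar_inj hPsi _ _ _ _ (pos _ cy) (pos _ cy')) [/= -> [k ek]].
  have k0 : k = 0.
    apply: (@small_angle R); move: (near_y0 _ cy) (near_y0 _ cy') => /= [d1 _] [d2 _].
    have -> : 2 * pi * k%:~R = (a' - y0.1) - (a - y0.1) by rewrite ek; ring.
    apply: le_lt_trans (ler_normB _ _) _; have := two_pi_gt1; lra.
  by rewrite ek k0 mulr0 addr0.
rewrite -[RHS]orient.
have h1E y : closure (ball y0 e) y -> h 1 y = Psi y - z.
  move=> cy; rewrite /h subrr mul0r add0r mul1r (gtr0_norm (pos _ cy)).
  by rewrite -surjective_pairing.
have t1 : 0 <= (1 : R) <= 1 by rewrite lexx ler01.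
rewrite yz (deg_translate hd Psi) //; last first.
  move=> y yb E; have [cy _] := proj1 (bdP _ _ oB) yb.
  by apply: (h_neq0 1 y t1 yb); rewrite h1E // E subrr.
apply: (deg_eq_closure hd) => //.
- exact: continuous_subspaceT.
- by move=> y; apply: h_neq0.
Qed.

Lemma local_degree H z i : z <> 0 -> continuous H -> H z = nu R i ->
  (exists a b c k, a * k - b * c != 0 /\ \forall y \near z, H y = H z + lin a b c k (y - z)) ->
  exists2 e0 : R, 0 < e0 & forall e, 0 < e <= e0 ->
    (forall x j, `|x - z| <= e -> H x = nu R j -> x = z) /\
    deg (displacement H) (ball z e) 0 = deg H (ball z e) (nu R i).
Proof.
move=> z0 cH Hz [a [b [c [k [D0 /nbhs_ballP [dl /= dl0 Haff]]]]]].
pose L := lin a b c k.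
have L0 w : L w = 0 -> w = 0 by exact: lin_eq0.
have cL : continuous L by exact: continuous_lin.
pose N := `|a| + `|b| + `|c| + `|k| + 1.
have N0 : 0 < N by rewrite ltr_wpDl // !addr_ge0.
have LN w : `|L w| <= N * `|w|.
  have W1 : `|w.1| <= `|w| by rewrite plane_norm le_max lexx.
  have W2 : `|w.2| <= `|w| by rewrite plane_norm le_max lexx orbT.
  have S p q : `|p * w.1 + q * w.2| <= (`|p| + `|q|) * `|w|.
    by apply: le_trans (ler_normD _ _) _; rewrite !normrM mulrDl lerD // ler_wpM2l.
  rewrite plane_norm_ler /L /lin /=; apply/andP; split; apply: le_trans (S _ _) _;
    rewrite ler_wpM2r // /N; have := normr_ge0 a; have := normr_ge0 b;
    have := normr_ge0 c; have := normr_ge0 k; lra.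
(* The three bounds keep H affine on the closed ball, keep |L (x - z)| at most 1, so that clamping
   has no effect and no other nu_j is attained, and keep the ball away from the origin. *)
pose e0 := Num.min (dl / 2) (Num.min N^-1 (`|z| / 2)).
have nz : 0 < `|z| by rewrite normr_gt0; exact/eqP.
exists e0; first by rewrite !lt_min !divr_gt0 // invr_gt0 N0.
move=> e /andP[e_gt0]; rewrite !le_min => /and3P[ed eN ez].
have oB : open (ball z e) by exact: ball_open.
have bB : bounded_set (ball z e) by exact: bounded_ball.
have aff x : `|x - z| <= e -> H x = nu R i + L (x - z).
  by move=> xz; rewrite -Hz; apply: Haff; apply/plane_ballP; lra.
have LE : L = lin a b c k by [].
clearbody L.
have L1 x : `|x - z| <= e -> `|L (x - z)| <= 1.
  move=> xz; apply: le_trans (LN _) _; rewrite -[leRHS](mulfV (lt0r_neq0 N0)).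
  by apply: ler_wpM2l; [exact: ltW | lra].
have uniq_zero x j : `|x - z| <= e -> H x = nu R j -> x = z.
  move=> xz; rewrite aff // => E; apply/eqP; rewrite -subr_eq0; apply/eqP/L0.
  have := L1 x xz; rewrite plane_norm_ler => /andP[h1 _].
  have {}E : L (x - z) = nu R j - nu R i by rewrite -E addrAC subrr add0r.
  have E1 : (L (x - z)).1 = 2 * pi * (j - i)%:~R by rewrite E /= intrB; ring.
  have ji : j - i = 0.
    by apply: (@small_angle R); rewrite -E1 (le_lt_trans h1) // two_pi_gt1.
  apply: plane_eq; first by rewrite E1 ji mulr0.
  by rewrite E /= subrr.
split=> //.
have Q0 w : turn_at z w = 0 -> w = 0 by exact: turn_at_eq0.
have cQ := continuous_turn_at z.
have cl x : closure (ball z e) x -> `|x - z| <= e by exact: closure_ball_norm.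
have zB : ball z e z by exact: ballxx.
have not_z x : bd (ball z e) x -> x <> z by move=> /(bdP _ _ oB) [_ nB] xz; apply: nB; rewrite xz.
have cQL : continuous (turn_at z \o L).
  by apply/continuous_cont_in => w; apply: (cont_in_comp (f := L) (cQ _)); cont.
transitivity (deg (fun x => (turn_at z \o L) (x - z)) (ball z e) 0); last first.
  rewrite (deg_single_zero hd cQL) //; last by move=> w /Q0 /L0.
  rewrite LE (ind_lin_of_ind1 hd) //; last exact: ind_turn_at.
  rewrite -LE -(deg_single_zero hd cL L0 oB bB zB) (deg_translate hd H) //; last first.
  - by move=> x xb /(uniq_zero _ _ (cl _ (proj1 xb))); exact: not_z.
  - exact: continuous_subspaceT.
  apply: (deg_eq_closure hd) => //.
  - by apply: continuous_subspaceT; cont.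
  - by move=> x /cl xz; rewrite aff // addrAC subrr add0r.
  - by move=> x /not_z xz /L0 /subr0_eq.
(* The base point moves from x to z without meeting the origin. No zero appears on the boundary,
   because turning p back to p puts the same condition on the parameters for every p other than
   0. *)
pose xt t x := (1 - t) *: x + t *: z.
have cxt : continuous (fun p : R * plane R => xt p.1 p.2) by rewrite /xt; cont.
have xt0 t x : 0 <= t <= 1 -> `|x - z| <= e -> xt t x <> 0.
  move=> /andP[t0 t1] xz E.
  have : z = z - xt t x by rewrite E subr0.
  have -> : z - xt t x = (1 - t) *: (z - x).
    by rewrite /xt !plane_scale; apply: plane_eq => /=; ring.
  move=> Ez; have : `|z| <= `|z - x|.
    by rewrite {1}Ez normrZ ger0_norm ?subr_ge0 // ler_piMl // lerBlDr lerDl.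
  by rewrite distrC; lra.
pose h t x := turn (xt t x) (L (x - z)).1 (expR (L (x - z)).2) - xt t x.
have ch : continuous (fun p : R * plane R => h p.1 p.2).
  have cT := continuous_turn hPsi.
  have cT' : continuous (fun p : R * plane R =>
      turn (xt p.1 p.2) (L (p.2 - z)).1 (expR (L (p.2 - z)).2)).
    apply/continuous_cont_in => p; apply: (cont_in_comp (f := fun p : R * plane R =>
      (xt p.1 p.2, (L (p.2 - z)).1, expR (L (p.2 - z)).2)) (cT _)).
    by cont.
  by rewrite /h; cont.
have h0E x : `|x - z| <= e -> displacement H x = h 0 x.
  move=> xz; rewrite /displacement /h /xt subr0 scale1r scale0r addr0 aff //=.
  by rewrite [2 * pi * _ + _]addrC (turn_int hPsi) add0r.
have h1E x : `|x - z| <= e -> h 1 x = (turn_at z \o L) (x - z).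
  move=> xz; rewrite /h /xt subrr scale0r add0r scale1r /= /turn_at.
  by have := L1 x xz; rewrite plane_norm_ler => /andP[d1 d2]; rewrite !clamp_id.
have h_neq0 t x : 0 <= t <= 1 -> bd (ball z e) x -> h t x <> 0.
  move=> t01 xb /subr0_eq; have xz := cl _ (proj1 xb).
  rewrite -[in RHS](turn01 hPsi (xt t x)) => /esym E.
  have [e2 [j ej]] := turn_inj hPsi _ _ _ _ _ (xt0 _ _ t01 xz) ltr01 (expR_gt0 _) E.
  apply: (not_z _ xb); apply: (uniq_zero x (i + j)) => //; rewrite aff //.
  apply: plane_eq => /=; first by rewrite ej intrD; ring.
  by rewrite add0r; apply: expR_inj; rewrite e2 expR0.
transitivity (deg (h 0) (ball z e) 0).
  apply: (deg_eq_closure hd) => //.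
  - exact/continuous_subspaceT/continuous_displacement.
  - by move=> x /cl; exact: h0E.
  - move=> x xb; rewrite h0E; last exact: cl (proj1 xb).
    by apply: h_neq0; rewrite // lexx ler01.
have t1 : 0 <= (1 : R) <= 1 by rewrite lexx ler01.
rewrite (deg_homotopy hd) //; last exact: continuous_subspaceT.
apply: (deg_eq_closure hd) => //.
- apply: continuous_subspaceT; apply/continuous_cont_in => x.
  by apply: (cont_in_comp (f := fun x : plane R => (1 : R, x)) (ch _)); cont.
- by move=> x /cl; exact: h1E.
- by move=> x; apply: h_neq0.
Qed.
End Core.

(** * Summation over the zeros away from the origin *)

Section Count.
Context {R : realType} {Psi : plane R -> plane R}.
Hypothesis hPsi : polar_coordinates Psi.
Implicit Types (H : plane R -> plane R) (U : set (plane R)) (x y z w : plane R).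
Let hd := brouwer_degree_deg hPsi.
Local Notation displacement := (displacement (Psi := Psi)).

(** Induction on the list of candidates. A ball around a relevant z is split off; there H takes no
    nu_i other than nu_i0, so both sides lose the same integer. *)
Lemma displacement_deg_finite H U (I : seq int) (zeros : seq (plane R)) :
  continuous H -> open U -> bounded_set U -> ~ closure U 0 -> uniq I ->
  (forall x i, closure U x -> H x = nu R i -> [/\ i \in I, U x, x \in zeros &
    exists a b c k, a * k - b * c != 0 /\ \forall y \near x, H y = H x + lin a b c k (y - x)]) ->
  deg (displacement H) U 0 = \sum_(i <- I) deg H U (nu R i).
Proof.
move=> cH + + + uI; have cD := continuous_displacement hPsi _ cH.
have neq0 (V : set (plane R)) x : ~ closure V 0 -> closure V x -> x <> 0 by move=> V0 Vx x0; rewrite x0 in Vx.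
elim: zeros U => [|z zeros IH] U oU bU U0 hU.
  rewrite (deg_none hd) //; last 2 first.
  - exact: continuous_subspaceT.
  - by move=> x cx /(displacement_eq0 hPsi _ _ (neq0 _ _ U0 cx)) [i /(hU _ _ cx)[]].
  rewrite big1 // => i _; apply: (deg_none hd) => //; first exact: continuous_subspaceT.
  by move=> x cx /(hU _ _ cx)[].
have [[Uz [i0 Hz]]|nz] := pselect (U z /\ exists i, H z = nu R i); last first.
  apply: IH => // x i cx Hx; have [iI Ux + aff] := hU _ _ cx Hx.
  by rewrite inE => /predU1P[xz|xs]; split=> //; case: nz; rewrite -xz; split=> //; exists i.
have cUz : closure U z by exact: subset_closure.
have [i0I _ _ aff] := hU _ _ cUz Hz.
have z0 := neq0 _ _ U0 cUz.
have [e0 e00 loc] := local_degree hPsi _ _ _ z0 cH Hz aff.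
have [r r0 rU] : exists2 r : R, 0 < r & ball z r `<=` U.
  have : nbhs z U by apply: open_nbhs_nbhs.
  by move=> /nbhs_ballP[r /= r0 rU]; exists r.
pose e := Num.min e0 (r / 2).
have e_gt0 : 0 < e by rewrite lt_min e00 divr_gt0.
have [ee0 er] : e <= e0 /\ e < r.
  have : e <= r / 2 by rewrite /e ge_min lexx orbT.
  by split; [rewrite /e ge_min lexx | lra].
have e_range : 0 < e <= e0 by rewrite e_gt0.
have [uniq_zero deg_z] := loc e e_range.
(* The circle at distance e from z belongs to neither piece, which is harmless: z is the only point
   of the closed ball where H takes a value nu_j. *)
pose B := ball z e; pose U' := U `&` [set x | e < `|x - z|].
have BU : B `<=` U by apply: subset_trans rU; apply: le_ball; exact: ltW.
have oB : open B by exact: ball_open.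
have bB : bounded_set B by exact: bounded_ball.
have oU' : open U'.
  apply: openI => //; have -> : [set x | e < `|x - z|] = (fun x => `|x - z|) @^-1` [set t : R | e < t] by [].
  by apply: open_comp; [move=> y _; cont | exact: open_gt].
have U'U : U' `<=` U by move=> x [].
have bU' : bounded_set U' by exact: bounded_subset U'U bU.
have cU'U : closure U' `<=` closure U by exact: closure_subset.
have BU'0 : B `&` U' = set0.
  rewrite -subset0 => x [/plane_ballP xz [_ /= zx]].
  by move: (lt_trans xz zx); rewrite ltxx.
have missed x : closure U x -> ~ (B `|` U') x -> forall i, H x <> nu R i.
  move=> cx nx i Hx; have [_ Ux _ _] := hU _ _ cx Hx.
  apply: nx; case: (ltP e `|x - z|) => xz; [by right; split | left].
  by rewrite (uniq_zero _ _ xz Hx); exact: ballxx.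
rewrite (brouwer_additivity hd oU bU _ oB oU' BU U'U BU'0); last 2 first.
- exact: continuous_subspaceT.
- move=> x cx nx /(displacement_eq0 hPsi _ _ (neq0 _ _ U0 cx)) [i]; exact: missed.
rewrite deg_z (IH U') //; last 2 first.
- by move=> /cU'U.
- move=> x i cx Hx; have [iI Ux + affx] := hU _ _ (cU'U _ cx) Hx.
  have ex : e <= `|x - z|.
    pose V := [set y : plane R | e <= `|y - z|].
    suff cV : closed V by apply: cV; apply: closure_subset cx => y [_ /ltW].
    have -> : V = (fun y => `|y - z|) @^-1` [set t : R | e <= t] by [].
    by apply: closed_comp; [move=> y _; cont | exact: closed_ge].
  have xz : x <> z by move=> xz; move: ex; rewrite xz subrr normr0 leNgt e_gt0.
  rewrite inE => /predU1P[//|xs]; split=> //; split=> //=.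
  by rewrite lt_neqAle ex andbT; apply/eqP => exz; apply: xz; apply: uniq_zero Hx; rewrite -exz.
under [RHS]eq_bigr => i _.
  rewrite (brouwer_additivity hd oU bU _ oB oU' BU U'U BU'0 (g := H) (v := nu R i)); last 2 first.
  - exact: continuous_subspaceT.
  - by move=> x cx nx; apply: missed.
  over.
rewrite big_split /=; congr (_ + _); rewrite (bigD1_seq i0) //= big1 ?addr0 // => i ii0.
apply: (deg_none hd) => //; first exact: continuous_subspaceT.
move=> x /closure_ball_norm xz Hx; have xz' := uniq_zero _ _ xz Hx.
case/negP: ii0; move: Hx; rewrite xz' Hz => -[] /eqP.
have p0 : 2 * pi != 0 :> R by rewrite mulf_neq0 // lt0r_neq0 // pi_gt0.
by rewrite (inj_eq (mulfI p0)) eqr_int => /eqP ->.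
Qed.

Lemma norm_nu (i : int) : `|nu R i| = 2 * pi * `|i|%:~R.
Proof.
have p0 : 0 < 2 * pi :> R by rewrite mulr_gt0 // pi_gt0.
rewrite plane_norm /= normr0 (max_idPl _) // normrM (gtr0_norm p0) intr_norm //.
Qed.

Lemma positive_gap (F : plane R -> plane R) (K : set (plane R)) (s : seq (plane R)) :
  compact K -> continuous F -> (forall x v, K x -> v \in s -> F x <> v) ->
  exists2 e : R, 0 < e & forall x v, K x -> v \in s -> e <= `|F x - v|.
Proof.
move=> cK cF; elim: s => [_|v s IH hs]; first by exists 1.
have [x w Kx ws|e1 e10 h1] := IH; first by apply: hs; rewrite // inE ws orbT.
have [[x0 Kx0]|nK] := pselect (exists x, K x); last by exists 1 => // x w Kx; case: nK; exists x.
have [c cinK hc] : exists2 c, c \in K & forall x, x \in K -> `|F c - v| <= `|F x - v|.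
  by apply: (@compact_EVT_min _ _ (fun x => `|F x - v|)) => //;
    [exists x0 | apply: continuous_subspaceT; cont].
have c0 : 0 < `|F c - v|.
  rewrite normr_gt0 subr_eq0; apply/eqP; apply: hs; first exact: set_mem.
  exact: mem_head.
exists (Num.min e1 `|F c - v|); first by rewrite lt_min e10.
move=> x w Kx; rewrite inE => /predU1P[->|ws].
  by rewrite ge_min hc ?orbT //; exact: mem_set.
by rewrite ge_min h1.
Qed.

Lemma displacement_deg H U (I : seq int) (M : R) :
  continuous H -> open U -> bounded_set U -> ~ closure U 0 -> uniq I ->
  (forall x, closure U x -> `|H x| <= M) -> (forall i, `|nu R i| <= M + 1 -> i \in I) ->
  (forall x i, bd U x -> H x <> nu R i) ->
  deg (displacement H) U 0 = \sum_(i <- I) deg H U (nu R i).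
Proof.
move=> cH oU bU U0 uI HM inI Hnu.
have [|e1 e10 gap] := positive_gap H (bd U) [seq nu R i | i <- I] (compact_bd _ bU) cH.
  by move=> x v bx /mapP[i _ ->]; exact: Hnu.
(* Below e1 the deformation takes no nu_i on the boundary; the bound 1 matches the margin in M + 1,
   so that every nu_i taken by the approximation has its index in I. *)
pose e := Num.min e1 1.
have [e_gt0 [ee1 el1]] : 0 < e /\ e <= e1 /\ e <= 1.
  by rewrite /e lt_min e10 ltr01 !ge_min !lexx orbT.
have [H' [cH' H'H [zeros hz]]] := generic_approximation H (closure U) [seq nu R i | i <- I] e cH (compact_closure _ bU) e_gt0.
have H'I x i : closure U x -> H' x = nu R i -> i \in I.
  move=> cx H'x; apply: inI; rewrite -H'x -[H' x](subrK (H x)).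
  apply: le_trans (ler_normD _ _) _; have := H'H _ cx; have := HM _ cx; lra.
pose G t x := (1 - t) *: H x + t *: H' x.
have cG : continuous (fun p : R * plane R => G p.1 p.2) by rewrite /G; cont.
have G0 : G 0 = H by apply/funext => x; rewrite /G subr0 scale1r scale0r addr0.
have G1 : G 1 = H' by apply/funext => x; rewrite /G subrr scale1r scale0r add0r.
have GI t x : 0 <= t <= 1 -> closure U x -> `|G t x - H x| < e.
  move=> /andP[t0 t1] cx; have -> : G t x - H x = t *: (H' x - H x).
    by rewrite /G !plane_scale; apply: plane_eq => /=; ring.
  rewrite normrZ ger0_norm //; apply: le_lt_trans (H'H _ cx).
  by rewrite ler_piMl.
have Gnu t x i : 0 <= t <= 1 -> bd U x -> G t x <> nu R i.
  move=> t01 bx Gx; have := GI t x t01 (proj1 bx); rewrite Gx => Hx.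
  have [iI|iI] := boolP (i \in I).
    have := gap x (nu R i) bx (map_f _ iI); rewrite distrC; lra.
  case/negP: iI; apply: inI; rewrite -[nu R i](subrK (H x)).
  apply: le_trans (ler_normD _ _) _; have := HM _ (proj1 bx); lra.
have H'nu x i : bd U x -> H' x <> nu R i by rewrite -G1; apply: Gnu; rewrite lexx ler01.
transitivity (deg (displacement H') U 0).
  rewrite -G0 -G1; apply: (deg_homotopy hd (fun t => displacement (G t))) => //.
    exact/continuous_subspaceT/continuous_displacement_param.
  move=> t x t01 bx; rewrite displacement_eq0 //; first by move=> [i]; exact: Gnu.
  by move=> x0; apply: U0; rewrite -x0; case: bx.
rewrite (displacement_deg_finite _ _ I zeros) //.
  apply: eq_bigr => i _; rewrite -G0 -G1; apply/esym.
  apply: (deg_homotopy hd G) => //; first exact: continuous_subspaceT.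
  by move=> t x t01; exact: Gnu.
move=> x i cx H'x; have iI := H'I _ _ cx H'x.
have [|xz aff] := hz x; first by rewrite H'x map_f.
split=> //; have [//|nU] := pselect (U x).
by case: (H'nu x i _ H'x); apply/(bdP _ _ oU).
Qed.

End Count.

(** * Lifts and the degree of their displacement *)

(** Two distinct integer values would force a half-integer in between. *)
Lemma int_valued_constant {R : realType} (f : R -> R) (b : R) : 0 <= b ->
  {within `[0, b]%classic, continuous f} ->
  (forall t, 0 <= t <= b -> exists k : int, f t = k%:~R) -> f b = f 0.
Proof.
move=> b0 cf fint.
have [k0 e0] : exists k : int, f 0 = k%:~R by apply: fint; rewrite lexx.
have [k1 e1] : exists k : int, f b = k%:~R by apply: fint; rewrite lexx b0.
have noval (m : int) : ~ (Num.min (f 0) (f b) <= m%:~R + 1 / 2 <= Num.max (f 0) (f b)).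
  move=> /(IVT b0 cf) [t]; rewrite in_itv /= => /fint [j ->] jm.
  have : (m < j)%R by rewrite -(@ltr_int R); lra.
  have : (j < m + 1)%R by rewrite -(@ltr_int R) intrD; lra.
  by lia.
rewrite e0 e1 in noval *.
case: (ltgtP k0 k1) => [k01|k10|-> //]; exfalso.
  apply: (noval k0); rewrite ge_min le_max.
  have : k0%:~R + 1 <= k1%:~R :> R by rewrite -[1]/(1%:~R) -intrD ler_int; lia.
  by move=> h; apply/andP; split; apply/orP; [left|right]; lra.
apply: (noval k1); rewrite ge_min le_max.
have : k1%:~R + 1 <= k0%:~R :> R by rewrite -[1]/(1%:~R) -intrD ler_int; lia.
by move=> h; apply/andP; split; apply/orP; [right|left]; lra.
Qed.

Lemma plane_tietze {R : realType} (K : set (plane R)) (F : plane R -> plane R) :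
  compact K -> {within K, continuous F} ->
  exists2 G : plane R -> plane R, continuous G & forall x, K x -> G x = F x.
Proof.
move=> cK cF; have [M hM] := compact_image_bounded K cK cF.
have clK : closed K by apply: compact_closed cK; exact: norm_hausdorff.
have M0 : 0 < `|M| + 1 by rewrite ltr_wpDl.
have bound x : K x -> `|F x| <= `|M| + 1.
  by move=> /hM; have := ler_norm M; lra.
have [||g1 [g1E cg1 _]] := continuous_bounded_extension pseudometric_normal clK (f := fun x => (F x).1) M0.
- by cont.
- by move=> x /bound; rewrite plane_norm_ler => /andP[].
have [||g2 [g2E cg2 _]] := continuous_bounded_extension pseudometric_normal clK (f := fun x => (F x).2) M0.
- by cont.
- by move=> x /bound; rewrite plane_norm_ler => /andP[].
exists (fun x => (g1 x, g2 x)); first by cont.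
by move=> x Kx; apply: plane_eq => /=; rewrite -?g1E -?g2E // inE.
Qed.

Lemma conv_between {R : realType} (A : set R) (p q r : R) :
  A p -> A q -> p <= r <= q -> Defs.conv A r.
Proof.
move=> Ap Aq /andP[pr rq] B [cB AB].
have [pq|pq] := eqVneq p q.
  have -> : r = p by apply/le_anti; rewrite pr pq rq.
  exact: AB.
have qp : 0 < q - p by rewrite subr_gt0 lt_neqAle pq (le_trans pr).
have t0 : 0 <= (q - r) / (q - p) by rewrite divr_ge0 ?subr_ge0 // ltW // -subr_gt0.
have t1 : (q - r) / (q - p) <= 1 by rewrite ler_pdivrMr // mul1r lerD2l lerN2.
have := cB p q (Itv01 t0 t1) (mem_set (AB _ Ap)) (mem_set (AB _ Aq)).
move=> /set_mem Br.
suff -> : r = (q - r) / (q - p) * p + (1 - (q - r) / (q - p)) * q by exact: Br.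
by field; exact: lt0r_neq0.
Qed.

Lemma bounded_nu_seq {R : realType} (b : R) :
  exists2 I : seq int, uniq I & forall i, `|nu R i| <= b -> i \in I.
Proof.
have p0 : 0 < 2 * pi :> R by rewrite mulr_gt0 // pi_gt0.
pose n := Num.trunc (`|b| / (2 * pi)).
have hn1 : `|b| / (2 * pi) < n.+1%:R by exact: truncnS_gt.
exists [seq (Posz k - Posz n)%R | k <- iota 0 (n + n).+1].
  by rewrite map_inj_uniq ?iota_uniq // => k l /addIr [].
move=> i ib; have : (`|i| < n.+1%:Z)%R.
  rewrite -(@ltr_int R); apply: le_lt_trans hn1; rewrite ler_pdivlMr // mulrC -norm_nu.
  by apply: le_trans ib _; exact: ler_norm.
move=> h; apply/mapP; exists (absz (i + Posz n)%R).
  by rewrite mem_iota; lia.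
by lia.
Qed.

Lemma two_pi_gt0 {R : realType} : 0 < 2 * pi :> R.
Proof. by rewrite mulr_gt0 // pi_gt0. Qed.

Section Final.
Context {R : realType} {Psi : plane R -> plane R}.
Hypothesis hPsi : polar_coordinates Psi.
Implicit Types (H : plane R -> plane R) (E U : set (plane R)) (x y z w : plane R).
Let hd := brouwer_degree_deg hPsi.
Local Notation displacement := (displacement (Psi := Psi)).
Local Notation turn := (turn (Psi := Psi)).
Local Notation polar_pt := (polar_pt (Psi := Psi)).

(** Both lifts cover the same path, so their angles differ by 2 pi times an integer that depends
    continuously on t and is k at t = 0. *)
Lemma lift_shift T E phi Phi y k : is_lift Psi T E phi Phi -> 0 <= T ->
  polar_preim Psi E y ->
  Phi T (y.1 + 2 * pi * k%:~R, y.2) = ((Phi T y).1 + 2 * pi * k%:~R, (Phi T y).2).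
Proof.
move=> [cPhi hPhi Phi0 PsiPhi] T0 Ey.
have [y0 PyE] := Ey.
pose y' : plane R := (y.1 + 2 * pi * k%:~R, y.2).
have Psiy' : Psi y' = Psi y by rewrite /y' polar_int // -surjective_pairing.
have Ey' : polar_preim Psi E y' by split; [exact: y0 | rewrite /= Psiy'].
have rel t : 0 <= t <= T -> (Phi t y').2 = (Phi t y).2 /\
    exists m : int, (Phi t y').1 = (Phi t y).1 + 2 * pi * m%:~R.
  move=> t0T; have tT : `[0, T]%classic t by rewrite /= in_itv.
  have := PsiPhi t y' tT Ey'; rewrite Psiy' -(PsiPhi t y tT Ey).
  rewrite [Phi t y']surjective_pairing [Phi t y]surjective_pairing /= => e.
  by apply: (polar_inj hPsi _ _ _ _ _ _ (esym e)); exact: hPhi.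
have cPhit w : polar_preim Psi E w -> {within `[0, T]%classic, continuous (fun t => Phi t w)}.
  move=> Ew; apply/within_cont_in => t tT.
  apply: (cont_in_comp_within (B := `[0, T]%classic `*` polar_preim Psi E)
    (g := fun p : R * plane R => Phi p.1 p.2) (f := fun t : R => (t, w))) => //.
  - by have /within_cont_in := cPhi; apply.
  - by cont.
pose f t := ((Phi t y').1 - (Phi t y).1) / (2 * pi).
have fT : f T = f 0.
  apply: int_valued_constant => //.
    have c1 := cPhit _ Ey; have c2 := cPhit _ Ey'.
    by rewrite /f; cont.
  move=> t /rel [_ [m e]]; exists m; rewrite /f e addrC addKr.
  by rewrite mulrC mulKf // lt0r_neq0 // two_pi_gt0.
have E1 : (Phi T y').1 - (Phi T y).1 = (Phi 0 y').1 - (Phi 0 y).1.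
  by apply: (mulIf _ fT); rewrite invr_neq0 // lt0r_neq0 // two_pi_gt0.
have [|e2 _] := rel T; first by rewrite T0 lexx.
apply: plane_eq; last exact: e2.
rewrite -[LHS](subrK (Phi T y).1) E1 !Phi0 //= /y'; ring.
Qed.

(* First shrink the radius of the subtracted identity to 0, then undo the half turn. *)
Lemma displacement_deg_origin H (e : R) : continuous H -> 0 < e ->
  (forall x, `|x| <= e -> H x = (pi, 0)) -> deg (displacement H) (ball 0 e) 0 = 1.
Proof.
move=> cH e0 He.
have oB : open (ball (0 : plane R) e) by exact: ball_open.
have bB : bounded_set (ball (0 : plane R) e) by exact: bounded_ball.
have bd_neq0 x : bd (ball 0 e) x -> x <> 0.
  by move=> /(bdP _ _ oB) [_ nB] x0; apply: nB; rewrite x0; exact: ballxx.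
have cT := continuous_turn hPsi.
have half k : pi <> 2 * pi * k%:~R :> R.
  have p0 := pi_gt0 R; move=> h.
  have : (1 : R) = (2 * k)%:~R by rewrite intrM; apply: (mulfI (lt0r_neq0 p0)); lra.
  by move=> /eqP; rewrite -[1]/(1%:~R) eqr_int => /eqP; lia.
pose h1 t x := turn x pi 1 - turn x 0 (1 - t).
have ch1 : continuous (fun p : R * plane R => h1 p.1 p.2).
  have c1 : continuous (fun p : R * plane R => turn p.2 pi 1).
    apply/continuous_cont_in => p.
    by apply: (cont_in_comp (f := fun p : R * plane R => (p.2, pi : R, 1 : R)) (cT _)); cont.
  have c2 : continuous (fun p : R * plane R => turn p.2 0 (1 - p.1)).
    apply/continuous_cont_in => p.
    by apply: (cont_in_comp (f := fun p : R * plane R => (p.2, 0 : R, 1 - p.1)) (cT _)); cont.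
  by rewrite /h1; cont.
pose h2 t x := turn x (pi * (1 - t)) 1.
have ch2 : continuous (fun p : R * plane R => h2 p.1 p.2).
  apply/continuous_cont_in => p.
  by apply: (cont_in_comp (f := fun p : R * plane R => (p.2, pi * (1 - p.1), 1 : R)) (cT _)); cont.
(* For t < 1 the angles pi and 0 are not congruent modulo 2 pi; for t = 1 only a point of nonzero
   radius is left. *)
have h1_neq0 t x : 0 <= t <= 1 -> bd (ball 0 e) x -> h1 t x <> 0.
  move=> /andP[t0 t1] /bd_neq0 x0 /subr0_eq E.
  have [t1'|t1'] := ltP t 1; last first.
    have tE : 1 - t = 0 by lra.
    rewrite tE in E; have z0 : turn x 0 0 = 0.
      by apply: (proj2 (polar_eq0 hPsi _)) => /=; rewrite ?normr0 ?mul0r //; exact: lexx.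
    have := turn_eq0 hPsi _ _ _ (etrans E z0) x0.
    by move/eqP; rewrite oner_eq0.
  have t10 : 0 < 1 - t by rewrite subr_gt0.
  have [_ [k]] := turn_inj hPsi _ _ _ _ _ x0 t10 ltr01 (esym E).
  by rewrite add0r; exact: half.
transitivity (deg (h1 0) (ball 0 e) 0).
  apply: (deg_eq_closure hd) => //.
  - exact/continuous_subspaceT/continuous_displacement.
  - move=> x /closure_ball_norm; rewrite subr0 => xe.
    by rewrite /displacement He //= expR0 /h1 subr0 turn01.
  - move=> x bx; rewrite /displacement He /= ?expR0; last first.
      by have := closure_ball_norm _ _ _ (proj1 bx); rewrite subr0.
    have := h1_neq0 0 x _ bx; rewrite /h1 subr0 turn01 //; apply.
    by rewrite lexx ler01.
rewrite (deg_homotopy hd) //; last exact: continuous_subspaceT.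
have -> : h1 1 = h2 0.
  apply/funext => x; rewrite /h1 /h2 subrr subr0 mulr1.
  have -> : turn x 0 0 = 0; last by rewrite subr0.
  by apply: (proj2 (polar_eq0 hPsi _)) => /=; rewrite ?normr0 ?mul0r //; exact: lexx.
rewrite (deg_homotopy hd) //; last 2 first.
- exact: continuous_subspaceT.
- move=> t x _ /bd_neq0 x0 /(turn_eq0 hPsi _ _ _) /(_ x0) /eqP.
  by rewrite oner_eq0.
have -> : h2 1 = id by apply/funext => x; rewrite /h2 subrr mulr0 turn01.
by apply: (brouwer_normalization hd) => //; exact: ballxx.
Qed.

(** Push H further in the direction s of the angle axis. Boundary values only move away from 2 pi i,
    and L is large enough for all of the closure to miss it in the end. *)
Lemma deg_half_plane H U i (s : R) : continuous H -> open U -> bounded_set U -> s ^+ 2 = 1 ->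
  (forall x, bd U x -> 0 < s * ((H x).1 - 2 * pi * i%:~R)) -> deg H U (nu R i) = 0.
Proof.
move=> cH oU bU s1 hs.
have [M hM] := compact_image_bounded _ (compact_closure _ bU) (continuous_subspaceT cH).
set a := 2 * pi * i%:~R in hs.
pose L := `|M| + `|a| + 1; have L0 : 0 < L by rewrite ltr_wpDl // addr_ge0.
pose h t x := H x + (t * (s * L), 0).
have ch : continuous (fun p : R * plane R => h p.1 p.2) by rewrite /h; cont.
have h0 : h 0 = H by apply/funext => x; rewrite /h mul0r; apply: plane_eq; rewrite /= addr0.
rewrite -h0 (deg_homotopy hd) //; last 2 first.
- exact: continuous_subspaceT.
- move=> t x /andP[t0 t1] /hs pos /(congr1 fst) /= e.
  have e' : s * ((H x).1 - a) = - (t * L * s ^+ 2) by rewrite /a -e; ring.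
  have : 0 <= t * L by rewrite mulr_ge0 // ltW.
  by move: pos; rewrite e' s1 mulr1; lra.
apply: (deg_none hd) => //; first by apply: continuous_subspaceT; rewrite /h; cont.
move=> x /hM; rewrite plane_norm_ler => /andP[h1 _] /(congr1 fst) /= e.
have e' : (H x).1 - a = - (s * L) by rewrite /a -e; ring.
have ns : `|s| = 1 by apply/eqP; rewrite -sqrp_eq1 // real_normK ?num_real // s1.
have : `|(H x).1 - a| = L by rewrite e' normrN normrM ns mul1r gtr0_norm.
have := ler_normB (H x).1 a; have := ler_norm M; rewrite /L; lra.
Qed.

End Final.

(** * From the lift to a map on the plane *)

Section Assembly.
Context {R : realType} {Psi : plane R -> plane R}.
Hypothesis hPsi : polar_coordinates Psi.
Implicit Types (H : plane R -> plane R) (E U : set (plane R)) (x y z w : plane R).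
Let hd := brouwer_degree_deg hPsi.
Local Notation displacement := (displacement (Psi := Psi)).
Local Notation turn := (turn (Psi := Psi)).
Local Notation polar_pt := (polar_pt (Psi := Psi)).

Definition lift_displacement (G : plane R -> plane R) x : plane R :=
  ((G (polar_pt x)).1 - (polar_pt x).1, ln ((G (polar_pt x)).2 / (polar_pt x).2)).

Lemma polar_pt_preim E x : E x -> polar_preim Psi E (polar_pt x).
Proof. by move=> Ex; have [h0 hx] := polar_ptP hPsi x; split; [exact: h0 | rewrite /= hx]. Qed.

(** By [lift_shift] the value does not depend on the preimage. Continuity can therefore be checked
    with a local branch instead of the discontinuous [polar_pt]. *)
Lemma lift_displacement_branch T E phi Phi y : is_lift Psi T E phi Phi -> 0 <= T ->
  0 < y.2 -> E (Psi y) ->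
  lift_displacement (Phi T) (Psi y) = ((Phi T y).1 - y.1, ln ((Phi T y).2 / y.2)).
Proof.
move=> hPhi T0 y0 Ey; have [k ek] := polar_pt_shift hPsi _ y0.
have Py : polar_preim Psi E y by split; [exact: ltW | exact: Ey].
rewrite /lift_displacement ek (lift_shift hPsi _ _ _ _ _ _ hPhi T0 Py) /=.
by apply: plane_eq => //=; ring.
Qed.

Lemma continuous_lift_displacement T E phi Phi : is_lift Psi T E phi Phi -> 0 <= T ->
  (forall x, E x -> x <> 0) -> {within E, continuous (lift_displacement (Phi T))}.
Proof.
move=> hPhi T0 E0; apply/within_cont_in => x Ex.
have [q [cq nq]] := polar_branch hPsi _ (E0 _ Ex).
have [q0 qx] := nbhs_singleton nq.
have TT : `[0, T]%classic T by rewrite /= in_itv /= T0 lexx.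
have [cPhi pPhi _ _] := hPhi.
have Pq : polar_preim Psi E (q x) by split; [exact: ltW | rewrite /= qx].
have cG : cont_in (polar_preim Psi E) (q x) (Phi T).
  apply: (cont_in_comp_within (B := `[0, T]%classic `*` polar_preim Psi E)
    (g := fun p : R * plane R => Phi p.1 p.2) (f := fun y : plane R => (T, y))) => //.
  - by have /within_cont_in := cPhi; apply.
  - by cont.
have cGq : cont_in E x (fun z => Phi T (q z)).
  apply: cont_in_comp_near cG (cont_in_at cq).
  by apply: filterS nq => z [qz0 qz] Ez; split; [exact: ltW | rewrite /= qz].
have cf : cont_in E x (fun z => ((Phi T (q z)).1 - (q z).1, ln ((Phi T (q z)).2 / (q z).2))).
  apply: cont_in_pair; first by cont.
  apply: cont_in_ln; first by rewrite divr_gt0 //; exact: pPhi.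
  apply: cont_in_mul; first by cont.
  by apply: cont_in_inv; [exact: lt0r_neq0 | cont].
have eqn : \forall z \near within E (nbhs x),
    ((Phi T (q z)).1 - (q z).1, ln ((Phi T (q z)).2 / (q z).2)) = lift_displacement (Phi T) z.
  have : \forall z \near x, E z ->
      ((Phi T (q z)).1 - (q z).1, ln ((Phi T (q z)).2 / (q z).2)) = lift_displacement (Phi T) z.
    apply: filterS nq => z [qz0 qz] Ez.
    by rewrite -[in RHS]qz (lift_displacement_branch _ _ _ _ _ hPhi T0 qz0) // qz.
  by [].
have e0 : ((Phi T (q x)).1 - (q x).1, ln ((Phi T (q x)).2 / (q x).2)) = lift_displacement (Phi T) x.
  by rewrite -[in RHS]qx (lift_displacement_branch _ _ _ _ _ hPhi T0 q0) // qx.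
rewrite /cont_in -e0.
exact: cvg_trans (near_eq_cvg eqn) cf.
Qed.

Lemma displacement_lift T E phi Phi H x : is_lift Psi T E phi Phi -> 0 <= T ->
  E x -> x <> 0 -> H x = lift_displacement (Phi T) x ->
  displacement H x = phi T x - x.
Proof.
move=> [_ pPhi _ PsiPhi] T0 Ex x0 Hx.
have TT : `[0, T]%classic T by rewrite /= in_itv /= T0 lexx.
have r0 := polar_pt_gt0 hPsi _ x0; have Px := polar_pt_preim _ _ Ex.
have G0 : 0 < (Phi T (polar_pt x)).2 by exact: pPhi.
have [_ px] := polar_ptP hPsi x.
rewrite /displacement Hx /lift_displacement /= lnK ?posrE ?divr_gt0 //.
rewrite /turn gtr0_norm ?divr_gt0 // divfK ?lt0r_neq0 // (addrC (polar_pt x).1) subrK -surjective_pairing.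
by rewrite PsiPhi // px.
Qed.

Lemma Deg_lift T U phi Phi H i : is_lift Psi T (bd U) phi Phi -> 0 <= T ->
  open U -> bounded_set U -> continuous H ->
  (forall x, bd U x -> x <> 0) ->
  (forall x, bd U x -> H x = lift_displacement (Phi T) x) ->
  (forall x, bd U x -> H x <> nu R i) ->
  Deg Psi (fun y => Phi T y - y) U (nu R i) = deg H U (nu R i).
Proof.
move=> hPhi T0 oU bU cH U0 HL Hnu.
have TT : `[0, T]%classic T by rewrite /= in_itv /= T0 lexx.
have [_ pPhi _ _] := hPhi.
set F := fun y => Phi T y - y.
have radius y : polar_preim Psi (bd U) y -> 0 < y.2.
  case=> [y0 /= by_]; rewrite lt0r; apply/andP; split; last exact: y0.
  by apply/eqP => e; apply: (U0 _ by_); apply/(polar_eq0 hPsi y0).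
have FH y : polar_preim Psi (bd U) y ->
    F y = ((H (Psi y)).1, y.2 * (expR (H (Psi y)).2 - 1)).
  move=> Py; have y0 := radius _ Py; have G0 : 0 < (Phi T y).2 by exact: pPhi.
  rewrite (HL _ (proj2 Py)) (lift_displacement_branch _ _ _ _ _ hPhi T0 y0 (proj2 Py)) /=.
  rewrite lnK ?posrE ?divr_gt0 // mulrBr mulr1 mulrC divfK ?lt0r_neq0 //.
(* [Deg] falls back on a default map if there is no extension, so one must be exhibited. In this one
   the factor y.2 vanishes on the axis and [Psi] is 0 there, which makes it constant for r = 0. *)
have ext : exists Fext, is_extension Psi F U Fext.
  have cPsi := polar_continuous hPsi.
  exists (fun y => ((H (Psi y)).1, y.2 * (expR (H (Psi y)).2 - 1))); split.
  - have cHP : {within chalfplane R, continuous (fun y => H (Psi y))}.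
      by apply/within_cont_in => y y0; apply: (cont_in_comp (cH _)); move/within_cont_in: cPsi; apply.
    by cont.
  - by move=> a r r0; rewrite (polar_periodic hPsi).
  - by move=> y Py; rewrite FH.
  - exists ((H 0).1, 0) => a; rewrite mul0r.
    by rewrite (proj2 (polar_eq0 hPsi (y := (a, 0)) (lexx _)) erefl).
rewrite /Deg; case: xgetP => [Fext _ [cF pF eF [c Fc]]|none]; last first.
  by case: ext => Fext hF; case: (none Fext).
have cD := continuous_descend hPsi _ _ cF pF Fc.
have DE x : bd U x -> descend Psi Fext x =
    ((H x).1, (polar_pt x).2 * (expR (H x).2 - 1)).
  move=> bx; have Px := polar_pt_preim _ _ bx.
  rewrite -[descend Psi Fext x]/(Fext (polar_pt x)) eF // FH //.
  by have [_ ->] := polar_ptP hPsi x.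
(* The extension picked by [xget] is known on the boundary only, which is all that the segment
   homotopy needs. *)
apply: (deg_segment hd) => //; try exact: continuous_subspaceT.
move=> t x t01 bx; rewrite DE // !plane_scale => /= -[e1 e2].
have r0 : 0 < (polar_pt x).2 by apply: (polar_pt_gt0 hPsi); exact: U0.
have H2 := mix_expR _ _ _ t01 r0 e2.
by apply: (Hnu _ bx); apply: plane_eq => //=; rewrite -e1; ring.
Qed.

Lemma cutoff H U : continuous H -> open U -> U 0 ->
  exists H' (e : R), [/\ continuous H', 0 < e, closure (ball 0 e) `<=` U,
    forall x, bd U x -> H' x = H x & forall x, `|x| <= e -> H' x = (pi, 0)].
Proof.
move=> cH oU U0.
have [r r0 rU] : exists2 r : R, 0 < r & ball (0 : plane R) r `<=` U.
  have : nbhs (0 : plane R) U by apply: open_nbhs_nbhs.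
  by move=> /nbhs_ballP[r /= r0 rU]; exists r.
(* Equal to 1 up to radius r / 2 and to 0 from radius r on; the boundary of U lies in the second
   region. *)
pose chi (x : plane R) : R := Num.max 0 (Num.min 1 (2 - 2 / r * `|x|)).
have chi1 x : `|x| <= r / 2 -> chi x = 1.
  move=> xr; have : 2 / r * `|x| <= 2 / r * (r / 2) by rewrite ler_wpM2l // divr_ge0 // ltW.
  rewrite (_ : 2 / r * (r / 2) = 1); last by field; exact: lt0r_neq0.
  by rewrite /chi => h; rewrite (min_idPl _) ?(max_idPr _) //; lra.
have chi0 x : r <= `|x| -> chi x = 0.
  move=> xr; have : 2 / r * r <= 2 / r * `|x| by rewrite ler_wpM2l // divr_ge0 // ltW.
  rewrite divfK ?lt0r_neq0 // /chi => h; apply/max_idPl.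
  by rewrite ge_min; apply/orP; right; lra.
exists (fun x => (1 - chi x) *: H x + chi x *: (pi, 0)), (r / 2); split.
- by rewrite /chi; cont.
- by rewrite divr_gt0.
- move=> x /closure_ball_norm h; apply: rU; apply/plane_ballP; lra.
- move=> x /(bdP _ _ oU) [_ nU]; rewrite chi0; first by rewrite subr0 scale1r scale0r addr0.
  by rewrite leNgt; apply/negP => xr; apply: nU; apply: rU; apply/plane_ballP; rewrite subr0.
- by move=> x /chi1 ->; rewrite subrr scale0r scale1r add0r.
Qed.

(** No nu_k is a half turn, so the removed disk contributes 1 to the displacement and nothing to the
    degrees of H. Outside it the origin is no longer in the closure. *)
Lemma displacement_deg_split H U (e : R) : continuous H -> open U -> bounded_set U ->
  0 < e -> closure (ball 0 e) `<=` U -> (forall x, `|x| <= e -> H x = (pi, 0)) ->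
  (forall x j, bd U x -> H x <> nu R j) ->
  let U' := U `&` [set x | e / 2 < `|x|] in
  [/\ open U' /\ bounded_set U', ~ closure U' 0,
      forall x j, bd U' x -> H x <> nu R j,
      deg (displacement H) U 0 = 1 + deg (displacement H) U' 0 &
      forall i, deg H U (nu R i) = deg H U' (nu R i)].
Proof.
move=> cH oU bU e0 eU He Hnu U'.
have cD := continuous_displacement hPsi _ cH.
have e20 : 0 < e / 2 by rewrite divr_gt0.
have half k : (pi, 0) <> nu R k.
  move=> [h]; have p0 := pi_gt0 R.
  have : (1 : R) = (2 * k)%:~R by rewrite intrM; apply: (mulfI (lt0r_neq0 p0)); lra.
  by move=> /eqP; rewrite -[1]/(1%:~R) eqr_int => /eqP; lia.
pose B := ball (0 : plane R) (e / 2).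
have oB : open B by exact: ball_open.
have bB : bounded_set B by exact: bounded_ball.
have BU : B `<=` U.
  move=> x xB; apply/eU/subset_closure; apply: le_ball xB; lra.
have oU' : open U'.
  apply: openI => //.
  have -> : [set x | e / 2 < `|x|] = (fun x : plane R => `|x|) @^-1` [set t : R | e / 2 < t] by [].
  by apply: open_comp; [move=> y _; cont | exact: open_gt].
have U'U : U' `<=` U by move=> x [].
have bU' : bounded_set U' by exact: bounded_subset U'U bU.
have cU'U : closure U' `<=` closure U by exact: closure_subset.
have far x : closure U' x -> e / 2 <= `|x|.
  pose V := [set y : plane R | e / 2 <= `|y|].
  suff cV : closed V by move=> cx; apply: cV; apply: closure_subset cx => y [_ /ltW].
  have -> : V = (fun y : plane R => `|y|) @^-1` [set t : R | e / 2 <= t] by [].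
  by apply: closed_comp; [move=> y _; cont | exact: closed_ge].
have U'0 : ~ closure U' 0 by move=> /far; rewrite normr0; lra.
have Hnu' x j : closure U x -> ~ U' x -> H x <> nu R j.
  move=> cx nx; have [Ux|nUx] := pselect (U x); last by apply: Hnu; apply/(bdP _ _ oU).
  have [xe|xe] := leP `|x| (e / 2); last by case: nx.
  by rewrite He; [exact: half | lra].
split=> //.
- by move=> x j /(bdP _ _ oU') [/cU'U cx nx]; exact: Hnu'.
- rewrite (brouwer_additivity hd oU bU _ oB oU' BU U'U) //; last 3 first.
  + exact: continuous_subspaceT.
  + rewrite -subset0 => x [/plane_ballP + [_ /=]]; rewrite subr0 => h1 h2.
    by have := lt_trans h1 h2; rewrite ltxx.
  + move=> x cx nx; have x0 : x <> 0.
      by move=> x0; apply: nx; left; rewrite x0; exact: ballxx.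
    move=> /(displacement_eq0 hPsi _ _ x0) [j]; apply: Hnu' => // xU'.
    by apply: nx; right.
  by rewrite (displacement_deg_origin hPsi) // => x xe; apply: He; lra.
- move=> i; apply: (deg_excision hd) => //; first exact: continuous_subspaceT.
  by move=> x cx nx; exact: Hnu'.
Qed.

End Assembly.

(** The sum over A collects the nonzero terms only. Without any finiteness of A, it suffices that
    the terms vanish off the intersection of A with the list. *)
Lemma fsum_seq {T : choiceType} (A : set T) (s : seq T) (f : T -> int) : uniq s ->
  (forall i, A i -> i \notin s -> f i = 0) -> (forall i, i \in s -> ~ A i -> f i = 0) ->
  \sum_(i \in A) f i = \sum_(i <- s) f i.
Proof.
move=> us hA hs; rewrite (fsbig_seq _ _ us).
rewrite -(fsbig_widen (A `&` [set` s]) A); last 2 first.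
- by move=> i [].
- move=> i [Ai nAi]; apply: hA => //; apply/negP => si; by apply: nAi; split.
apply: fsbig_widen; first by move=> i [].
by move=> i [/= si nAi]; apply: hs => // Ai; apply: nAi; split.
Qed.

Theorem theorem3p1 (R : realType) (Psi : plane R -> plane R)
  (hPsi : polar_coordinates Psi)
  (T : R) (hT : 0 < T)
  (U : set (plane R)) (hUo : open U) (hUb : bounded_set U)
  (phi : R -> plane R -> plane R)
  (hphi : {within `[0, T]%classic `*` closure U,
             continuous (fun p : R * plane R => phi p.1 p.2)})
  (hphi0 : forall x, closure U x -> phi 0 x = x)
  (hphin0 : forall t x, `[0, T]%classic t -> bd U x -> phi t x <> 0)
  (Phi : R -> plane R -> plane R) (hPhi : is_lift Psi T (bd U) phi Phi)
  (f_T F_T : plane R -> plane R)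
  (hf_T : f_T = fun x => phi T x - x)
  (hF_T : F_T = fun y => Phi T y - y)
  (hfn0 : forall x, bd U x -> f_T x <> 0) :
  (U 0 ->
     deg f_T U 0 = 1 + \sum_(i \in Sigma Psi F_T (bd U)) Deg Psi F_T U (nu R i))
  /\
  (~ closure U 0 ->
     deg f_T U 0 = \sum_(i \in Sigma Psi F_T (bd U)) Deg Psi F_T U (nu R i)).
Proof.
have hd := brouwer_degree_deg hPsi; have T0 := ltW hT.
have bd0 x : bd U x -> x <> 0.
  move=> bx; rewrite -(hphi0 _ (proj1 bx)); apply: hphin0 => //.
  by rewrite /= in_itv /= lexx.
have [H0 cH0 H0E] := plane_tietze _ _ (compact_bd _ hUb)
  (continuous_lift_displacement hPsi _ _ _ _ hPhi T0 bd0).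
have dispE H : (forall x, bd U x -> H x = H0 x) ->
    forall x, bd U x -> displacement (Psi := Psi) H x = f_T x.
  move=> HH0 x bx; rewrite hf_T.
  by apply: (displacement_lift hPsi _ _ _ _ _ _ hPhi T0 bx (bd0 _ bx)); rewrite HH0 // H0E.
have Hnu H : (forall x, bd U x -> H x = H0 x) -> forall x i, bd U x -> H x <> nu R i.
  move=> HH0 x i bx Hx; apply: (hfn0 _ bx); rewrite -(dispE H HH0 _ bx).
  by apply/(displacement_eq0 hPsi _ _ (bd0 _ bx)); exists i.
have cf : {within closure U, continuous f_T}.
  have c1 : {within closure U, continuous (fun x => phi T x)}.
    apply/within_cont_in => x cx; apply: (cont_in_comp_within (B := `[0, T]%classic `*` closure U)
      (g := fun p : R * plane R => phi p.1 p.2) (f := fun y : plane R => (T, y))) => //.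
    - by move=> y cy; split=> //; rewrite /= in_itv /= T0 lexx.
    - by have /within_cont_in := hphi; apply; split=> //; rewrite /= in_itv /= T0 lexx.
    - by cont.
  by rewrite hf_T; cont.
have degf H : continuous H -> (forall x, bd U x -> H x = H0 x) ->
    deg f_T U 0 = deg (displacement (Psi := Psi) H) U 0.
  move=> cH HH0; apply: (deg_bd_eq hd) => //.
  - exact/continuous_subspaceT/continuous_displacement.
  - by move=> x bx; rewrite (dispE H).
have DegH H i : continuous H -> (forall x, bd U x -> H x = H0 x) ->
    Deg Psi F_T U (nu R i) = deg H U (nu R i).
  move=> cH HH0; rewrite hF_T; apply: (Deg_lift hPsi _ _ _ _ _ _ hPhi) => //.
  - by move=> x bx; rewrite HH0 // H0E.
  - by move=> x j; exact: Hnu.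
have p0 := @two_pi_gt0 R.
have rotE x : bd U x -> rotation Psi F_T x = (H0 x).1 / (2 * pi).
  by move=> bx; rewrite H0E // hF_T.
have Deg_outside i : ~ Sigma Psi F_T (bd U) i -> Deg Psi F_T U (nu R i) = 0.
  move=> nS; rewrite (DegH H0) //; pose a : R := 2 * pi * i%:~R.
  (* Either all angles on the boundary exceed a, or some p has angle at most a. In the second case a
     boundary angle at or above a would put i between two rotation numbers, hence in Sigma. *)
  have [[p [bp pa]]|np] := pselect (exists p, bd U p /\ (H0 p).1 <= a); last first.
    apply: (deg_half_plane hPsi _ _ _ 1) => // [|x bx]; first by rewrite expr1n.
    rewrite mul1r subr_gt0 ltNge; apply/negP => xa; apply: np; by exists x.
  apply: (deg_half_plane hPsi _ _ _ (-1)) => // [|x bx]; first by rewrite sqrrN expr1n.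
  rewrite mulN1r opprB subr_gt0 ltNge; apply/negP => ax; apply: nS.
  have E r : (r <= a) = (r / (2 * pi) <= i%:~R) by rewrite ler_pdivrMr // mulrC.
  have E' r : (a <= r) = (i%:~R <= r / (2 * pi)) by rewrite ler_pdivlMr // mulrC.
  apply: (conv_between _ (rotation Psi F_T p) (rotation Psi F_T x)).
  - by exists p.
  - by exists x.
  - by rewrite !rotE // -E -E' pa ax.
(* Indices of Sigma outside I contribute 0 because |H| is at most M on the closure, and indices of I
   outside Sigma contribute 0 by [Deg_outside]. *)
have sum_eq H M I : continuous H -> (forall x, bd U x -> H x = H0 x) -> uniq I ->
    (forall x, closure U x -> `|H x| <= M) -> (forall i, `|nu R i| <= M + 1 -> i \in I) ->
    \sum_(i \in Sigma Psi F_T (bd U)) Deg Psi F_T U (nu R i) = \sum_(i <- I) deg H U (nu R i).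
  move=> cH HH0 uI HM inI.
  rewrite (fsum_seq _ I) //.
  - by apply: eq_bigr => i _; rewrite (DegH H).
  - move=> i _ /negP iI; rewrite (DegH H) //; apply: (deg_none hd) => //.
      exact: continuous_subspaceT.
    by move=> x /HM + Hx; rewrite Hx => h; apply: iI; apply: inI; lra.
  - by move=> i _; exact: Deg_outside.
split=> U0.
  have [H [e [cH e0 eU HH0 He]]] := cutoff _ _ cH0 hUo U0.
  have [M HM] := compact_image_bounded _ (compact_closure _ hUb) (continuous_subspaceT cH).
  have [I uI inI] := bounded_nu_seq (M + 1).
  have [[oU' bU'] U'0 Hnu' split1 split2] :=
    displacement_deg_split hPsi _ _ _ cH hUo hUb e0 eU He (Hnu H HH0).
  rewrite (degf H) // split1 (sum_eq H M I) //; congr (_ + _).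
  rewrite (displacement_deg hPsi _ _ I M) //.
    by apply: eq_bigr => i _; rewrite split2.
  by move=> x cx; apply: HM; apply: closure_subset cx => z [].
have [M HM] := compact_image_bounded _ (compact_closure _ hUb) (continuous_subspaceT cH0).
have [I uI inI] := bounded_nu_seq (M + 1).
rewrite (degf H0) // (sum_eq H0 M I) // (displacement_deg hPsi _ _ I M) //.
by move=> x i; exact: Hnu.
Qed.
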